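(* Let $N,L\ge1$ and let $\Phi\in\mathbb{R}^{N\times L}$ be a known matrix with columns $\Phi_1,\dots,\Phi_L$. Let $\gamma=(\gamma_1,\dots,\gamma_L)^T\in(0,\infty)^L$ and $\xi\in(0,\infty)$ be unknown deterministic parameters, $\Upsilon=\mathrm{diag}(\gamma_1,\dots,\gamma_L)$, and $y=\Phi x+n$ with $x\sim\mathcal{N}(0,\Upsilon)$, $n\sim\mathcal{N}(0,\xi I_N)$ independent. Let $p(y;\gamma,\xi)$ be the marginal density of $y$, $\Sigma_y=\xi I_N+\Phi\Upsilon\Phi^T$ and $\theta=[\gamma^T,\xi]^T\in\mathbb{R}^{L+1}$. Then: (i) the log likelihood satisfies the regularity condition $\mathbb{E}_{Y;\gamma,\xi}[\nabla_\theta\log p(y;\gamma,\xi)]=0$ for all $\gamma\in(0,\infty)^L$ and $\xi>0$; (ii) the Fisher information matrix of the marginalized model is $$\mathbf{M}_\xi^\theta=\begin{bmatrix}\mathbf{M}_\xi^\theta(\gamma)&\mathbf{M}_\xi^\theta(\gamma,\xi)\\ \mathbf{M}_\xi^\theta(\xi,\gamma)&\mathbf{M}_\xi^\theta(\xi)\end{bmatrix},$$ where, for $1\le i,j\le L$, $$(\mathbf{M}_\xi^\theta(\gamma))_{ij}=\tfrac12(\Phi_j^T\Sigma_y^{-1}\Phi_i)^2,\qquad \mathbf{M}_\xi^\theta(\xi)=\tfrac12\mathrm{Tr}(\Sigma_y^{-2}),\qquad (\mathbf{M}_\xi^\theta(\gamma,\xi))_i=(\mathbf{M}_\xi^\theta(\xi,\gamma))_i=\tfrac12\Phi_i^T\Sigma_y^{-2}\Phi_i,$$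 and, whenever $\mathbf{M}_\xi^\theta$ is non-singular, every admissible estimator $\hat\theta(y)$ of $\theta$ satisfies $\mathbf{E}_\xi^\theta\succeq(\mathbf{M}_\xi^\theta)^{-1}$.
   Context: $A\succeq B$ means $A-B$ is positive semidefinite. $\mathbb{E}_{Y;\gamma,\xi}$ denotes expectation with respect to $p(y;\gamma,\xi)$. The Fisher information matrix is $\mathbf{M}_\xi^\theta=-\mathbb{E}_{Y;\gamma,\xi}[\nabla_\theta\nabla_\theta^T\log p(y;\gamma,\xi)]$. For a measurable estimator $\hat\theta:\mathbb{R}^N\to\mathbb{R}^{L+1}$ the MSE matrix is $\mathbf{E}_\xi^\theta=\mathbb{E}_{Y;\gamma,\xi}[(\theta-\hat\theta(y))(\theta-\hat\theta(y))^T]$. An estimator is admissible if, for every $(\gamma,\xi)\in(0,\infty)^{L+1}$, $\mathbf{E}_\xi^\theta$ exists (has finite entries) and $\mathbb{E}_{Y;\gamma,\xi}[\hat\theta(y)]=\theta$ (unbiasedness). *)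

(* Defs.v *)
From HB Require Import structures.
From mathcomp Require Import all_boot all_order all_algebra.
From mathcomp Require Import all_classical all_reals all_analysis.
From mathcomp Require Import measurable_realfun.
Set Implicit Arguments.
Unset Strict Implicit.
Unset Printing Implicit Defensive.
Import Order.TTheory GRing.Theory Num.Theory.
Import numFieldNormedType.Exports.
Local Open Scope classical_set_scope.
Local Open Scope ring_scope.

Section LebesgueTuple.
Context {R : realType}.

Definition cons_pair n (z : measurableTypeR R * n.-tuple R) : n.+1.-tuple R :=
  [tuple of z.1 :: z.2].

Lemma measurable_cons_pair n : measurable_fun setT (@cons_pair n).
Proof. by apply: (@measurable_cons _ _ _ R fst n snd). Qed.

Section step.
Variables (n : nat) (m : {sigma_finite_measure set (n.-tuple R) -> \bar R}).

Definition lebesgue_cons : set (n.+1.-tuple R) -> \bar R :=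
  pushforward (lebesgue_measure \x m)%E (@cons_pair n).

Let mu : {measure set (n.+1.-tuple R) -> \bar R} :=
  measure_function_pushforward__canonical__measure_function_Measure
    (lebesgue_measure \x m)%E (@measurable_cons_pair n).

HB.instance Definition _ := Measure.copy lebesgue_cons mu.

Let uncons (t : n.+1.-tuple R) : measurableTypeR R * n.-tuple R :=
  (thead t, [tuple of behead t]).

Let measurable_uncons : measurable_fun setT uncons.
Proof.
apply/measurable_fun_pairP; split.
  exact: measurable_tnth.
exact: measurable_behead.
Qed.

Let lebesgue_cons_sigma_finite : sigma_finite setT lebesgue_cons.
Proof.
have /sigma_finiteP[F [TF ndF Foo]] := sigma_finiteT (@lebesgue_measure R).
have /sigma_finiteP[G [TG ndG Goo]] := sigma_finiteT m.
exists (fun k => uncons @^-1` (F k `*` G k)).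
  rewrite -preimage_bigcup -[LHS](preimage_setT uncons); congr (_ @^-1` _).
  apply/esym; rewrite -subTset => -[x y] _.
  have [i _ Fx] : (\bigcup_i F i) x by rewrite -TF.
  have [j _ Gy] : (\bigcup_i G i) y by rewrite -TG.
  exists (maxn i j) => //; split.
    by move: x Fx; exact/subsetPset/ndF/leq_maxl.
  by move: y Gy; exact/subsetPset/ndG/leq_maxr.
move=> k; have [mF Fk] := Foo k; have [mG Gk] := Goo k; split.
  rewrite -[X in measurable X]setTI; apply: measurable_uncons => //.
  exact: measurableX.
rewrite /lebesgue_cons /pushforward -comp_preimage.
rewrite (_ : uncons \o _ = id); last first.
  by apply/funext => -[a t]; rewrite /uncons /=; congr (_, _); apply/val_inj.
by rewrite preimage_id product_measure1E// lte_mul_pinfty// ge0_fin_numE.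
Qed.

HB.instance Definition _ := Measure_isSigmaFinite.Build _ _ _ lebesgue_cons
  lebesgue_cons_sigma_finite.

End step.

(* Lebesgue measure on R^n as an iterated product of [lebesgue_measure],
   transported along R * n.-tuple R ~ n.+1.-tuple R *)
Fixpoint lebesgue_tuple n :
    {sigma_finite_measure set (n.-tuple R) -> \bar R} :=
  if n is n'.+1 then lebesgue_cons (lebesgue_tuple n') else \d_[tuple].

End LebesgueTuple.

Definition colv {R : realType} n (t : n.-tuple R) : 'cV[R]_n :=
  \col_i tnth t i.

(* density at t of N(mu, S), for a symmetric positive definite covariance S *)
Definition gaussian_pdf {R : realType} n (mu : 'cV[R]_n) (S : 'M[R]_n)
    (t : n.-tuple R) : R :=
  (Num.sqrt ((2 * pi) ^+ n * \det S))^-1 *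
  expR (- (((colv t - mu)^T *m invmx S *m (colv t - mu)) 0 0 / 2)).

Section Calculus.
Context {R : realType} (n : nat).
Implicit Types (f : 'cV[R]_n -> R) (t : 'cV[R]_n).

Definition grad f t : 'cV[R]_n := \col_i 'D_(delta_mx i 0) f t.

Definition hessian f t : 'M[R]_n :=
  \matrix_(i, j) 'D_(delta_mx i 0) (fun s => 'D_(delta_mx j 0) f s) t.

End Calculus.

Definition psd {R : realType} n (A : 'M[R]_n) : Prop :=
  A^T = A /\ forall v : 'cV[R]_n, 0 <= (v^T *m A *m v) 0 0.

Definition loewner_ge {R : realType} n (A B : 'M[R]_n) : Prop :=
  psd (A - B).

Section Model.
Context {R : realType} {N L : nat}.
Variable Phi : 'M[R]_(N, L).
Implicit Types (g : 'cV[R]_L) (xi : R) (t : 'cV[R]_(L + 1)).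

Definition Upsilon g : 'M[R]_L := diag_mx g^T.

Definition Sigma_y g xi : 'M[R]_N := xi%:M + Phi *m Upsilon g *m Phi^T.

Definition theta g xi : 'cV[R]_(L + 1) := col_mx g xi%:M.

(* p(y) = \int p(y | x) p(x) dx, with x ~ N(0, Upsilon) and, as the noise
   N(0, xi I) is independent of x, y | x ~ N(Phi x, xi I); see
   [marginal_pdfP] below *)
Definition marginal_pdf g xi (y : N.-tuple R) : R :=
  \int[lebesgue_tuple L]_x
    (gaussian_pdf (Phi *m colv x) xi%:M y * gaussian_pdf 0 (Upsilon g) x).

Definition loglik (y : N.-tuple R) t : R :=
  ln (marginal_pdf (usubmx t) (dsubmx t 0 0) y).

(* [Rintegral] is 0 when the integral is infinite, so existence of an
   expectation is stated separately from its value *)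
Definition has_expectation g xi m k (F : N.-tuple R -> 'M[R]_(m, k)) : Prop :=
  forall i j, (lebesgue_tuple N).-integrable setT
    (fun y => (F y i j * marginal_pdf g xi y)%:E).

Definition expectation_y g xi m k (F : N.-tuple R -> 'M[R]_(m, k)) :
    'M[R]_(m, k) :=
  \matrix_(i, j) \int[lebesgue_tuple N]_y (F y i j * marginal_pdf g xi y).

Definition fisher g xi : 'M[R]_(L + 1) :=
  - expectation_y g xi (fun y => hessian (loglik y) (theta g xi)).

Definition sqerr g xi (est : N.-tuple R -> (L + 1).-tuple R) (y : N.-tuple R) :
    'M[R]_(L + 1) :=
  (theta g xi - colv (est y)) *m (theta g xi - colv (est y))^T.

Definition mse g xi est : 'M[R]_(L + 1) :=
  expectation_y g xi (sqerr g xi est).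

Definition admissible (est : N.-tuple R -> (L + 1).-tuple R) : Prop :=
  measurable_fun setT est /\
  forall g xi, (forall i, 0 < g i 0) -> 0 < xi ->
    [/\ has_expectation g xi (sqerr g xi est),
        has_expectation g xi (fun y => colv (est y)) &
        expectation_y g xi (fun y => colv (est y)) = theta g xi].

End Model.

Section Density.
Context {R : realType}.

Definition shift_tuple n (a t : n.-tuple R) : n.-tuple R :=
  [tuple tnth t i + tnth a i | i < n].

Lemma measurable_shift_tuple n (a : n.-tuple R) :
  measurable_fun setT (shift_tuple a).
Proof.
apply/measurable_fun_tnthP => i.
rewrite (_ : _ \o _ = fun t : n.-tuple R => tnth t i + tnth a i).
  by apply: measurable_funD => //; exact: measurable_tnth.
by apply/funext => t; rewrite /= tnth_mktuple.
Qed.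

Lemma lebesgue_measure_shift (a : R) (A : set (measurableTypeR R)) :
  measurable A ->
  lebesgue_measure ((fun x => x + a) @^-1` A) = lebesgue_measure A.
Proof.
move=> mA.
have ms : measurable_fun setT ((fun x => x + a) : measurableTypeR R -> measurableTypeR R).
  by apply: measurable_funD.
pose mu : {measure set (measurableTypeR R) -> \bar R} :=
  measure_function_pushforward__canonical__measure_function_Measure
    (@lebesgue_measure R) ms.
apply/esym/(@lebesgue_measure_unique _ mu) => // _ [[b c]] _ <-.
rewrite /mu /= /pushforward.
rewrite (_ : _ @^-1` _ = `]b - a, c - a]%classic).
  rewrite !lebesgue_measure_itv/= !lte_fin ltrD2r.
  by rewrite -!EFinD opprB addrA subrK.
by apply/seteqP; split => x /=; rewrite !in_itv/= ltrBlDr lerBrDr.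
Qed.

Lemma lebesgue_tuple_shift n (a : n.-tuple R) (A : set (n.-tuple R)) :
  measurable A ->
  lebesgue_tuple n (shift_tuple a @^-1` A) = lebesgue_tuple n A.
Proof.
elim: n a A => [|n IH] a A mA.
  rewrite (_ : shift_tuple a = id) ?preimage_id//.
  by apply/funext => t; rewrite [LHS]tuple0 [RHS]tuple0.
pose a' : n.-tuple R := [tuple of behead a].
pose s (z : measurableTypeR R * n.-tuple R) : measurableTypeR R * n.-tuple R :=
  (z.1 + thead a, shift_tuple a' z.2).
have ms : measurable_fun setT s.
  apply/measurable_fun_pairP; split => /=.
    by apply: measurable_funD.
  exact: measurableT_comp (measurable_shift_tuple a') measurable_snd.
have mC : measurable (@cons_pair R n @^-1` A).
  by rewrite -[X in measurable X]setTI; exact: measurable_cons_pair.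
rewrite /= /lebesgue_cons /pushforward.
pose mu : {measure set (measurableTypeR R * n.-tuple R) -> \bar R} :=
  measure_function_pushforward__canonical__measure_function_Measure
    (lebesgue_measure \x lebesgue_tuple n)%E ms.
rewrite [RHS](@product_measure_unique _ _ _ _ _ _ _ mu) //.
  rewrite /mu/= /pushforward; congr (_ _); apply/funext => -[x t] /=.
  rewrite (_ : shift_tuple a _ = cons_pair (s (x, t)))//.
  apply/eq_from_tnth => i; rewrite tnth_mktuple.
  case: (unliftP ord0 i) => [j ->|->]; last by [].
  rewrite /cons_pair !tnthS tnth_mktuple /a' tnth_behead; congr (_ + tnth _ _).
  by apply/val_inj; rewrite /= inordK// ltnS ltn_ord.
move=> B C mB mC'; rewrite /mu/= /pushforward.
rewrite (_ : s @^-1` _ = ((fun x => x + thead a) @^-1` B) `*` (shift_tuple a' @^-1` C)) //.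
  rewrite product_measure1E.
  - by rewrite IH//; congr (_ * _)%E; exact: lebesgue_measure_shift.
  - rewrite -[X in measurable X]setTI.
    have mm : measurable_fun setT ((fun x => x + thead a) : measurableTypeR R -> measurableTypeR R) by apply: measurable_funD.
    exact: mm.
  - by rewrite -[X in measurable X]setTI; exact: measurable_shift_tuple.
Qed.

Lemma integral_lebesgue_tuple_shift n (a : n.-tuple R) (f : n.-tuple R -> \bar R) :
  measurable_fun setT f -> (forall t, 0 <= f t)%E ->
  (\int[lebesgue_tuple n]_t f (shift_tuple a t) =
   \int[lebesgue_tuple n]_t f t)%E.
Proof.
move=> mf f0; pose mu : {measure set (n.-tuple R) -> \bar R} :=
  measure_function_pushforward__canonical__measure_function_Measure
    (lebesgue_tuple n) (measurable_shift_tuple a).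
transitivity (\int[mu]_t f t)%E.
  by rewrite ge0_integral_pushforward//; exact: measurable_shift_tuple.
by apply: eq_measure_integral => A mA _; exact: lebesgue_tuple_shift.
Qed.

Lemma measurable_colv d (T : measurableType d) n (F : T -> n.-tuple R) i :
  measurable_fun setT F -> measurable_fun setT (fun z => colv (F z) i 0).
Proof.
move=> /measurable_fun_tnthP mF; under eq_fun do rewrite mxE; exact: mF.
Qed.

Lemma measurable_gaussian_pdf d (T : measurableType d) n (mu : T -> 'cV[R]_n)
    (S : 'M[R]_n) (F : T -> n.-tuple R) :
  (forall i, measurable_fun setT (fun z => mu z i 0)) ->
  measurable_fun setT F ->
  measurable_fun setT (fun z => gaussian_pdf (mu z) S (F z)).
Proof.
move=> mmu mF; rewrite /gaussian_pdf.
have mv i : measurable_fun setT (fun z => (colv (F z) - mu z) i 0).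
  rewrite (_ : (fun _ => _) = fun z => colv (F z) i 0 - mu z i 0).
    by apply: measurable_funB => //; exact: measurable_colv.
  by apply/funext => z; rewrite !mxE.
apply: measurable_funM => //; apply: measurableT_comp => //.
apply: measurable_funN; apply: measurable_funM => //.
rewrite (_ : (fun _ => _) = fun z => \sum_j
    (\sum_k (colv (F z) - mu z) k 0 * invmx S k j) * (colv (F z) - mu z) j 0); last first.
  apply/funext => z; rewrite mxE; apply: eq_bigr => j _; congr (_ * _).
  by rewrite mxE; apply: eq_bigr => k _; rewrite mxE.
apply: measurable_sum => j; apply: measurable_funM => //.
by apply: measurable_sum => k; exact: measurable_funM.
Qed.

Lemma gaussian_pdf_ge0 n (mu : 'cV[R]_n) S t : 0 <= gaussian_pdf mu S t.
Proof. by rewrite mulr_ge0 ?invr_ge0 ?sqrtr_ge0 ?expR_ge0. Qed.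

Lemma gaussian_pdf_scalar_le n (mu : 'cV[R]_n) (xi : R) t : 0 < xi ->
  gaussian_pdf mu xi%:M t <= (Num.sqrt ((2 * pi) ^+ n * \det (xi%:M : 'M[R]_n)))^-1.
Proof.
move=> xi0; rewrite /gaussian_pdf ler_piMr ?invr_ge0 ?sqrtr_ge0// -expR0 ler_expR.
rewrite oppr_le0 divr_ge0// invmx_scalar -mulmxA mul_scalar_mx -scalemxAr mxE.
rewrite mulr_ge0 ?invr_ge0 ?(ltW xi0)// mxE sumr_ge0// => i _.
by rewrite [_^T _ _]mxE -expr2 sqr_ge0.
Qed.

Lemma gaussian_pdf_shift n (a t : n.-tuple R) S :
  gaussian_pdf (colv a) S (shift_tuple a t) = gaussian_pdf 0 S t.
Proof.
rewrite /gaussian_pdf (_ : colv _ - _ = colv t - 0)//.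
by apply/matrixP => i j; rewrite !mxE tnth_mktuple addrK subr0.
Qed.

Section joint_density.
Context d1 d2 (T1 : measurableType d1) (T2 : measurableType d2).
Variables (m1 : {sigma_finite_measure set T1 -> \bar R})
  (m2 : {sigma_finite_measure set T2 -> \bar R}).
Variables (f : T1 -> R) (g : T2 -> R).
Hypotheses (f0 : forall x, 0 <= f x) (g0 : forall x, 0 <= g x).
Hypotheses (mf : measurable_fun setT f) (mg : measurable_fun setT g).
Local Open Scope ereal_scope.

Let fg (z : T1 * T2) : \bar R := (f z.1 * g z.2)%:E.

Let fg0 z : 0 <= fg z. Proof. by rewrite lee_fin mulr_ge0. Qed.

Let mfg : measurable_fun setT fg.
Proof.
by apply/measurable_EFinP; apply: measurable_funM; exact: measurableT_comp.
Qed.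

Let nu (C : set (T1 * T2)) := \int[m1 \x m2]_(z in C) fg z.

Let nu0 : nu set0 = 0. Proof. exact: integral_set0. Qed.

Let nu_ge0 C : 0 <= nu C. Proof. exact: integral_ge0. Qed.

Let nu_sigma_additive : semi_sigma_additive nu.
Proof.
move=> F mF tF mUF; rewrite /nu ge0_integral_bigcup//.
  by apply: is_cvg_ereal_nneg_natsum_cond => n _ _; exact: integral_ge0.
exact: measurable_funTS.
Qed.

HB.instance Definition _ := isMeasure.Build _ _ _ nu nu0 nu_ge0 nu_sigma_additive.

Lemma joint_density d (T : measurableType d) (P : probability T R)
    (X : {mfun T >-> T1}) (Y : {mfun T >-> T2}) :
  (forall A, measurable A -> distribution P X A = \int[m1]_(x in A) (f x)%:E) ->
  (forall A, measurable A -> distribution P Y A = \int[m2]_(x in A) (g x)%:E) ->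
  (forall A B, measurable A -> measurable B ->
    P (X @^-1` A `&` Y @^-1` B) = P (X @^-1` A) * P (Y @^-1` B)) ->
  forall C, measurable C ->
    P ((fun w => (X w, Y w)) @^-1` C) =
    \int[m1 \x m2]_(z in C) (f z.1 * g z.2)%:E.
Proof.
move=> dX dY ind C mC.
have mXY : measurable_fun setT (fun w => (X w, Y w)).
  by apply/measurable_fun_pairP; split; exact: measurable_funPT.
pose J : {measure set (T1 * T2) -> \bar R} :=
  measure_function_pushforward__canonical__measure_function_Measure P mXY.
pose muX := [the probability _ _ of distribution P X].
pose muY := [the probability _ _ of distribution P Y].
transitivity ((muX \x muY) C).
  by rewrite (@product_measure_unique _ _ _ _ _ muX muY J).
rewrite (@product_measure_unique _ _ _ _ _ muX muY nu)// => A B mA mB.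
rewrite /muX /muY /= dX// dY// /nu integral_mkcond fubini_tonelli1; last 2 first.
- by apply/(measurable_restrictT _ _).1 => //; [exact: measurableX|exact: measurable_funTS].
- by move=> z; exact: erestrict_ge0.
rewrite /fubini_F [in RHS]integral_mkcond -ge0_integralZr//; last 3 first.
- by apply/(measurable_restrictT _ _).1 => //; apply/measurable_EFinP; exact: measurable_funTS.
- by move=> x _; apply: erestrict_ge0 => t _; rewrite lee_fin.
- by apply: integral_ge0 => y _; rewrite lee_fin.
apply: eq_integral => x _; rewrite [in RHS]patchE; case: ifPn => [xA|xA].
  rewrite -ge0_integralZl//; last 3 first.
  - by apply/measurable_EFinP; exact: measurable_funTS.
  - by move=> y _; rewrite lee_fin.
  - by rewrite lee_fin.
  rewrite [RHS]integral_mkcond; apply: eq_integral => y _.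
  by rewrite !patchE in_setX xA /=; case: ifPn.
rewrite mul0e; apply: integral0_eq => y _.
by rewrite patchE in_setX (negbTE xA).
Qed.

End joint_density.

Definition observe N L (Phi : 'M[R]_(N, L)) (x : L.-tuple R)
    (w : N.-tuple R) : N.-tuple R :=
  [tuple (Phi *m colv x + colv w) i 0 | i < N].

(* If x ~ N(0, Upsilon) and w ~ N(0, xi I) are independent, then
   [marginal_pdf] is a density of Phi x + w *)
Lemma marginal_pdfP d (T : measurableType d) (P : probability T R) N L
    (Phi : 'M[R]_(N, L)) (g : 'cV[R]_L) (xi : R)
    (X : {mfun T >-> L.-tuple R}) (W : {mfun T >-> N.-tuple R}) :
  0 < xi ->
  (forall A, measurable A -> distribution P X A =
    \int[lebesgue_tuple L]_(x in A) (gaussian_pdf 0 (Upsilon g) x)%:E)%E ->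
  (forall A, measurable A -> distribution P W A =
    \int[lebesgue_tuple N]_(w in A) (gaussian_pdf 0 xi%:M w)%:E)%E ->
  (forall A B, measurable A -> measurable B ->
    P (X @^-1` A `&` W @^-1` B) = P (X @^-1` A) * P (W @^-1` B))%E ->
  forall A, measurable A ->
    P [set z | A (observe Phi (X z) (W z))] =
    (\int[lebesgue_tuple N]_(y in A) (marginal_pdf Phi g xi y)%:E)%E.
Proof.
move=> xi0 dX dW ind A mA.
pose a (x : L.-tuple R) : N.-tuple R := [tuple (Phi *m colv x) i 0 | i < N].
have aE x : colv (a x) = Phi *m colv x.
  by apply/matrixP => i j; rewrite mxE tnth_mktuple ord1.
have obsE x w : observe Phi x w = shift_tuple (a x) w.
  by apply/eq_from_tnth => i; rewrite !tnth_mktuple !mxE addrC.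
have mPhi i : measurable_fun setT (fun x : L.-tuple R => (Phi *m colv x) i 0).
  under eq_fun do rewrite mxE; apply: measurable_sum => j.
  by apply: measurable_funM => //; exact: measurable_colv.
have mobs : measurable_fun setT
    (fun z : L.-tuple R * N.-tuple R => observe Phi z.1 z.2).
  apply/measurable_fun_tnthP => i.
  rewrite (_ : _ \o _ = fun z : L.-tuple R * N.-tuple R =>
    (Phi *m colv z.1) i 0 + colv z.2 i 0); last first.
    by apply/funext => z; rewrite /= tnth_mktuple mxE.
  apply: measurable_funD; first exact: measurableT_comp (mPhi i) measurable_fst.
  by apply: measurable_colv; exact: measurable_snd.
have mC : measurable ((fun z => observe Phi z.1 z.2) @^-1` A).
  by rewrite -[X in measurable X]setTI; exact: mobs.
have mgX : measurable_fun setT (fun x => gaussian_pdf 0 (Upsilon g) x).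
  by apply: measurable_gaussian_pdf.
have mgW : measurable_fun setT (fun w : N.-tuple R => gaussian_pdf 0 xi%:M w).
  by apply: measurable_gaussian_pdf.
have mgY : measurable_fun setT (fun z : L.-tuple R * N.-tuple R =>
    gaussian_pdf (Phi *m colv z.1) xi%:M z.2).
  apply: measurable_gaussian_pdf => // i.
  exact: measurableT_comp (mPhi i) measurable_fst.
rewrite -[LHS]/(P ((fun z => (X z, W z)) @^-1` ((fun z => observe Phi z.1 z.2) @^-1` A))).
rewrite (@joint_density _ _ _ _ (lebesgue_tuple L) (lebesgue_tuple N) _ _ _ _ _ _ _ _ P X W dX dW ind)//;
  last 2 first.
- by move=> x; exact: gaussian_pdf_ge0.
- by move=> x; exact: gaussian_pdf_ge0.
pose h x y := ((gaussian_pdf (Phi *m colv x) xi%:M y *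
   gaussian_pdf 0 (Upsilon g) x)%:E * (\1_A y)%:E)%E.
have h0 x y : (0 <= h x y)%E.
  by rewrite mule_ge0// lee_fin// mulr_ge0// gaussian_pdf_ge0.
have mh : measurable_fun setT (fun z : L.-tuple R * N.-tuple R => h z.1 z.2).
  apply: emeasurable_funM; apply/measurable_EFinP.
    by apply: measurable_funM => //; exact: measurableT_comp mgX measurable_fst.
  by apply: measurableT_comp.
transitivity (\int[lebesgue_tuple L]_x \int[lebesgue_tuple N]_y h x y)%E.
  rewrite integral_mkcond fubini_tonelli1; last 2 first.
  - apply/(measurable_restrictT _ _).1 => //; apply/measurable_EFinP.
    apply: measurable_funTS; apply: measurable_funM.
      exact: measurableT_comp mgX measurable_fst.
    exact: measurableT_comp mgW measurable_snd.
  - move=> z; apply: erestrict_ge0 => t _.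
    by rewrite lee_fin mulr_ge0// gaussian_pdf_ge0.
  apply: eq_integral => x _; rewrite /fubini_F.
  rewrite -[RHS](integral_lebesgue_tuple_shift (a x)); last 2 first.
  - by have := measurableT_comp mh (@pair1_measurable _ _ (L.-tuple R) (N.-tuple R) x).
  - by move=> t; exact: h0.
  apply: eq_integral => w _; rewrite /h -aE gaussian_pdf_shift indicE patchE.
  rewrite (_ : ((x, w) \in _) = (shift_tuple (a x) w \in A)); last first.
    by rewrite -obsE; apply/idP/idP; rewrite !inE.
  by case: ifPn => _; rewrite ?mule1 ?mule0// mulrC.
rewrite (@fubini_tonelli _ _ _ _ _ (lebesgue_tuple L) (lebesgue_tuple N)
  (fun z => h z.1 z.2))//=.
rewrite [RHS]integral_mkcond; apply: eq_integral => y _.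
rewrite patchE /h indicE; case: ifPn => yA; last first.
  by apply: integral0_eq => x _; rewrite mule0.
under eq_integral do rewrite mule1.
rewrite /marginal_pdf /Rintegral fineK// ge0_fin_numE; last first.
  by apply: integral_ge0 => x _; rewrite lee_fin mulr_ge0// gaussian_pdf_ge0.
pose c := (Num.sqrt ((2 * pi) ^+ N * \det (xi%:M : 'M[R]_N)))^-1.
have iX : (\int[lebesgue_tuple L]_x (gaussian_pdf 0 (Upsilon g) x)%:E = 1)%E.
  by rewrite -dX// probability_setT.
apply: (@le_lt_trans _ _
  (\int[lebesgue_tuple L]_x (c%:E * (gaussian_pdf 0 (Upsilon g) x)%:E))%E).
  apply: ge0_le_integral => //.
  - by move=> x _; rewrite lee_fin mulr_ge0// gaussian_pdf_ge0.
  - apply/measurable_EFinP; apply: measurable_funM => //.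
    by apply: measurable_gaussian_pdf.
  - by apply: measurable_funeM; apply/measurable_EFinP.
  - move=> x _; rewrite -EFinM lee_fin ler_wpM2r ?gaussian_pdf_ge0//.
    exact: gaussian_pdf_scalar_le.
rewrite ge0_integralZl//.
- by rewrite iX mule1 ltry.
- exact/measurable_EFinP.
- by move=> x _; rewrite lee_fin gaussian_pdf_ge0.
- by rewrite lee_fin invr_ge0 sqrtr_ge0.
Qed.

End Density.

(* Main.v *)
From HB Require Import structures.
Require Import Defs.
From mathcomp Require Import all_boot all_order all_algebra.
From mathcomp Require Import all_classical all_reals all_analysis.
From mathcomp Require Import ring lra perm measurable_realfun.
Set Implicit Arguments.
Unset Strict Implicit.
Unset Printing Implicit Defensive.
Import Order.TTheory GRing.Theory Num.Theory.
Import numFieldNormedType.Exports.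
Local Open Scope classical_set_scope.
Local Open Scope ring_scope.

(** With t = (gamma, xi), the covariance [cov t] of the observation is linear in
    t, and completing the square shows that the marginal density is the centered
    Gaussian density with covariance [cov t].  Everything then follows from
    differentiating integrals [h |-> \int F * p_(S + h A)] under the integral
    sign, which is legitimate as soon as F is integrable against p_(2 S):
    F = 1 gives the second moments E[y^T B y] = tr (B S), and with them the mean
    of the score and the Fisher information; F = y^T B y gives the covariance of
    two scores; and F = v . est, for an unbiased estimator est, gives
    E[(v . est) (u . score)] = v . u.  The bound is the nonnegativity of
    E[(v . (theta - est) + u . score)^2] at u = M^-1 v. *)

(** * Quadratic forms and positive definite matrices *)

Section QuadraticForms.
Context {R : realType}.

(** Differentiating an unbiasedness identity under the integral needs a majorant for an arbitrary
    estimator, of which only moments are controlled. Doubling the covariance supplies it: for small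
    h the Gaussian density with covariance S + h A, even multiplied by its quadratic score, is at
    most a constant times the density with covariance 2 S. By linearity 2 S is the covariance at the
    parameter 2 theta, where [admissible] again gives integrability of the estimator. Quantifying
    over all parameters thus takes the place of the usual interchange hypothesis. Only first
    derivatives are taken under the integral. The Hessian of the log density is found in closed form
    and averaged through second moments; the covariance of scores is computed separately, and the
    two agree as explicit traces. The closed forms hold only for invertible or positive definite
    matrices and positive parameters. Each is therefore differentiated as an equality valid in a
    neighbourhood, and openness lemmas accompany the formulas. *)

Definition qf n (A : 'M[R]_n) (y : 'cV[R]_n) : R := (y^T *m A *m y) 0 0.

Definition spd n (S : 'M[R]_n) : Prop :=
  S^T = S /\ forall v : 'cV[R]_n, v != 0 -> 0 < qf S v.

Lemma qfE n (A : 'M[R]_n) y :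
  qf A y = \sum_i \sum_j A i j * (y i 0 * y j 0).
Proof.
rewrite /qf mxE exchange_big; apply: eq_bigr => j _.
by rewrite mxE mulr_suml; apply: eq_bigr => i _; rewrite mxE; ring.
Qed.

Lemma qfD n (A B : 'M[R]_n) y : qf (A + B) y = qf A y + qf B y.
Proof. by rewrite /qf mulmxDr mulmxDl mxE. Qed.

Lemma qfN n (A : 'M[R]_n) y : qf (- A) y = - qf A y.
Proof. by rewrite /qf mulmxN mulNmx mxE. Qed.

Lemma qfZ n k (A : 'M[R]_n) y : qf (k *: A) y = k * qf A y.
Proof. by rewrite /qf -scalemxAr -scalemxAl mxE. Qed.

Lemma qf_mx0 n (A : 'M[R]_n) : qf A 0 = 0.
Proof. by rewrite /qf mulmx0 mxE. Qed.

Lemma qf1E n (y : 'cV[R]_n) : qf 1%:M y = \sum_i y i 0 ^+ 2.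
Proof.
by rewrite /qf mulmx1 mxE; apply: eq_bigr => i _; rewrite mxE expr2.
Qed.

Lemma qf1_ge0 n (y : 'cV[R]_n) : 0 <= qf 1%:M y.
Proof. by rewrite qf1E sumr_ge0// => i _; exact: sqr_ge0. Qed.

Lemma spd_qf_ge0 n (S : 'M[R]_n) y : spd S -> 0 <= qf S y.
Proof.
by move=> [_ S0]; have [->|/S0/ltW//] := eqVneq y 0; rewrite qf_mx0.
Qed.

(** Termwise [2 * |u * v| <= u ^+ 2 + v ^+ 2]. The crude constant is continuous in the entries, so
    entrywise convergence of matrices controls their forms uniformly in y. *)
Lemma qf_le n (A : 'M[R]_n) y :
  `|qf A y| <= (\sum_i \sum_j `|A i j|) * qf 1%:M y.
Proof.
rewrite qfE mulr_suml (le_trans (ler_norm_sum _ _ _))// ler_sum// => i _.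
rewrite mulr_suml (le_trans (ler_norm_sum _ _ _))// ler_sum// => j _.
rewrite normrM ler_wpM2l// qf1E.
have le_sum k : y k 0 ^+ 2 <= \sum_i y i 0 ^+ 2.
  by rewrite (bigD1 k)//= lerDl sumr_ge0// => l _; exact: sqr_ge0.
have := le_sum i; have := le_sum j.
set u := y i 0; set v := y j 0; move=> hj hi.
have := sqr_ge0 (u - v); have := sqr_ge0 (u + v) => h1 h2.
by rewrite ler_norml; apply/andP; split; nra.
Qed.

Lemma bilin_sym n (S : 'M[R]_n) (u v : 'cV[R]_n) : S^T = S ->
  (u^T *m S *m v) 0 0 = (v^T *m S *m u) 0 0.
Proof.
move=> sS; rewrite -[LHS]trace_mx11 -mxtrace_tr trace_mx11.
by rewrite !trmx_mul trmxK sS mulmxA.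
Qed.

Lemma qfD_vec n (S : 'M[R]_n) (u v : 'cV[R]_n) : S^T = S ->
  qf S (u + v) = qf S u + 2 * (u^T *m S *m v) 0 0 + qf S v.
Proof.
move=> sS; have mxD (A B : 'M[R]_1) : (A + B) 0 0 = A 0 0 + B 0 0 by rewrite mxE.
rewrite /qf [(_ + _)^T]linearD /= !mulmxDl !mulmxDr !mxD (bilin_sym v u sS); ring.
Qed.

Lemma qfZ_vec n (S : 'M[R]_n) (v : 'cV[R]_n) a :
  qf S (a *: v) = a ^+ 2 * qf S v.
Proof.
by rewrite /qf [(_ *: _)^T]linearZ /= -!scalemxAl -scalemxAr !scalerA mxE expr2.
Qed.

Lemma qf_congr n m (A : 'M[R]_m) (B : 'M[R]_(n, m)) y :
  qf (B *m A *m B^T) y = qf A (B^T *m y).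
Proof. by rewrite /qf trmx_mul trmxK !mulmxA. Qed.

Lemma spdD_congr n m (S : 'M[R]_n) (A : 'M[R]_m) (B : 'M[R]_(n, m)) :
  spd S -> spd A -> spd (S + B *m A *m B^T).
Proof.
move=> [sS S0] spdA; split=> [|v v0].
  by rewrite linearD /= sS !trmx_mul trmxK spdA.1 mulmxA.
by rewrite qfD qf_congr ltr_pwDl ?S0// spd_qf_ge0.
Qed.

Lemma spd_unitmx n (S : 'M[R]_n) : spd S -> S \in unitmx.
Proof.
move=> [sS S0]; rewrite unitmxE unitfE; apply/det0P => -[v v0 vS0].
have /S0 : v^T != 0 by rewrite -trmx0 (inj_eq (@trmx_inj _ _ _)).
by rewrite /qf trmxK vS0 mul0mx mxE ltxx.
Qed.

Lemma qf_invmx n (S : 'M[R]_n) y : S^T = S -> S \in unitmx ->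
  qf S (invmx S *m y) = qf (invmx S) y.
Proof.
by move=> sS Su; rewrite /qf trmx_mul trmx_inv sS -!mulmxA mulKVmx.
Qed.

Lemma spd_inv n (S : 'M[R]_n) : spd S -> spd (invmx S).
Proof.
move=> spdS; have Su := spd_unitmx spdS; case: (spdS) => sS S0.
split=> [|v v0]; first by rewrite trmx_inv sS.
have /S0 : invmx S *m v != 0.
  by apply: contra_neq v0 => /(congr1 (mulmx S)); rewrite mulKVmx// mulmx0.
by rewrite qf_invmx.
Qed.

Lemma spdZ n (S : 'M[R]_n) k : 0 < k -> spd S -> spd (k *: S).
Proof.
move=> k0 [sS S0]; split=> [|v v0]; first by rewrite linearZ /= sS.
by rewrite qfZ mulr_gt0// S0.
Qed.

(* Expand [0 <= qf S (y - b^-1 S^-1 y)] where b bounds the form of [S^-1]. *)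
Lemma spd_coercive n (S : 'M[R]_n) : spd S ->
  exists2 c, 0 < c & forall y, c * qf 1%:M y <= qf S y.
Proof.
move=> spdS; have Su := spd_unitmx spdS; case: (spdS) => sS _.
pose b := 1 + \sum_i \sum_j `|invmx S i j|.
have b0 : 0 < b.
  by rewrite ltr_pwDl// sumr_ge0// => i _; rewrite sumr_ge0.
exists b^-1 => [|y]; first by rewrite invr_gt0.
have := spd_qf_ge0 (y + - b^-1 *: (invmx S *m y)) spdS.
rewrite qfD_vec// qfZ_vec -scalemxAr [X in _ * X]mxE -mulmxA mulKVmx//.
rewrite qf_invmx//.
rewrite (_ : (y^T *m y) 0 0 = qf 1%:M y); last by rewrite /qf mulmx1.
have : qf (invmx S) y <= b * qf 1%:M y.
  rewrite (le_trans (ler_norm _))// (le_trans (qf_le _ _))//.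
  by rewrite ler_wpM2r ?qf1_ge0// lerDr.
move: (qf1_ge0 y); set q := qf 1%:M y; set r := qf (invmx S) y; set s := qf S y.
move=> q0 rb h.
have : (- b^-1) ^+ 2 * r <= b^-1 * q.
  rewrite sqrrN expr2 -mulrA ler_pM2l ?invr_gt0//.
  by rewrite ler_pdivrMl.
by lra.
Qed.

(** * Schur complement of the first coordinate *)

Section Schur.
Variables (n : nat) (P : 'M[R]_(1 + n)).
Hypothesis spdP : spd P.

Definition schur_pivot : R := ulsubmx P 0 0.
Definition schur_compl : 'M[R]_n :=
  drsubmx P - schur_pivot^-1 *: (dlsubmx P *m (dlsubmx P)^T).

Local Notation p := schur_pivot.
Local Notation q := (dlsubmx P).

Let blockP : P = block_mx p%:M q^T q (drsubmx P).
Proof.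
rewrite -[LHS]submxK {1}[ulsubmx P]mx11_scalar; congr block_mx.
by rewrite -[in RHS]spdP.1 -trmx_ursub trmxK.
Qed.

Let qf_block (x : R) (z : 'cV[R]_n) : qf P (col_mx x%:M z) =
  p * x ^+ 2 + 2 * x * (q^T *m z) 0 0 + qf (drsubmx P) z.
Proof.
have mxD (A B : 'M[R]_1) : (A + B) 0 0 = A 0 0 + B 0 0 by rewrite mxE.
have mxZ a (A : 'M[R]_1) : (a *: A) 0 0 = a * A 0 0 by rewrite mxE.
rewrite /qf {1}blockP tr_col_mx tr_scalar_mx mul_row_block mul_row_col.
rewrite mul_mx_scalar !mul_scalar_mx mulmxDl -scalemxAl !(mxD, mxZ).
have -> : (z^T *m q) 0 0 = (q^T *m z) 0 0.
  by rewrite -[LHS]trace_mx11 -mxtrace_tr trace_mx11 trmx_mul trmxK.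
by rewrite mxE eqxx mulr1n; ring.
Qed.

Lemma schur_pivot_gt0 : 0 < p.
Proof.
have := spdP.2 (col_mx 1%:M 0); rewrite qf_block mulmx0 qf_mx0 mxE.
rewrite mulr0 expr1n mulr1 !addr0; apply.
apply/eqP => /matrixP/(_ (lshift n 0) 0); rewrite col_mxEu !mxE eqxx.
by move/eqP; rewrite oner_eq0.
Qed.

(** Completing the square in the first coordinate. The complement inherits positivity from this, and
    in a Gaussian integral the first coordinate can be integrated out with the others held fixed. *)
Lemma qf_schur (x : R) (z : 'cV[R]_n) : qf P (col_mx x%:M z) =
  p * (x + p^-1 * (q^T *m z) 0 0) ^+ 2 + qf schur_compl z.
Proof.
rewrite qf_block /schur_compl qfD qfN qfZ.
have -> : qf (q *m q^T) z = ((q^T *m z) 0 0) ^+ 2.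
  rewrite -{1}[q]mulmx1 qf_congr qf1E big_ord1; congr (_ ^+ 2).
by field; rewrite gt_eqF// schur_pivot_gt0.
Qed.

Lemma spd_schur : spd schur_compl.
Proof.
split=> [|z z0].
  rewrite /schur_compl linearB linearZ /= trmx_mul trmxK; congr (_ - _).
  by rewrite -{2}spdP.1 trmx_drsub.
(* The first coordinate is chosen to annihilate the square in [qf_schur]. *)
have := spdP.2 (col_mx (- (p^-1 * (q^T *m z) 0 0))%:M z).
rewrite qf_schur addNr expr0n mulr0 add0r; apply.
by apply: contra_neq z0 => /eqP; rewrite col_mx_eq0 => /andP[_ /eqP].
Qed.

Lemma det_schur : \det P = p * \det schur_compl.
Proof.
(* Clear the column below the pivot by a unit triangular factor, of determinant 1. *)
have : \det (block_mx 1%:M 0 (- p^-1 *: q) 1%:M *m P) = p * \det schur_compl.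
  rewrite [X in _ *m X]blockP mulmx_block !mul1mx !mul0mx !addr0 mul_mx_scalar scalerA.
  rewrite mulrN divff ?gt_eqF ?schur_pivot_gt0// scaleN1r addNr det_ublock.
  by rewrite det_scalar1 /schur_compl -scalemxAl scaleNr addrC.
by rewrite det_mulmx det_lblock !det1 !mul1r.
Qed.

End Schur.

Lemma spd_det_gt0 n (S : 'M[R]_n) : spd S -> 0 < \det S.
Proof.
elim: n S => [|n IH] S spdS; first by rewrite det_mx00.
by rewrite (det_schur spdS) mulr_gt0 ?schur_pivot_gt0// IH//; exact: spd_schur.
Qed.

End QuadraticForms.

(** * Inverse and determinant of the covariance of y *)

Section Marginal.
Context {R : realType} {N L : nat}.
Variables (Phi : 'M[R]_(N, L)) (g : 'cV[R]_L) (xi : R).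
Hypotheses (g0 : forall i, 0 < g i 0) (xi0 : 0 < xi).

Lemma spd_scalar n : spd (xi%:M : 'M[R]_n).
Proof.
split=> [|v v0]; first by rewrite tr_scalar_mx.
rewrite -[xi%:M]scalemx1 qfZ mulr_gt0// lt_neqAle qf1_ge0 andbT eq_sym.
apply: contra_neq v0; rewrite qf1E => /eqP; rewrite psumr_eq0 => [|i _]; last exact: sqr_ge0.
move=> /allP v0; apply/matrixP => i j; rewrite ord1 mxE; apply/eqP.
by have := v0 i (mem_index_enum i); rewrite sqrf_eq0.
Qed.

Lemma spd_Upsilon : spd (Upsilon g).
Proof.
split=> [|v v0]; first by rewrite tr_diag_mx.
have [i vi] : exists i, v i 0 != 0.
  apply/existsP; apply: contraNT v0; rewrite negb_exists => /forallP v0.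
  by apply/eqP/matrixP => i j; rewrite ord1 mxE; apply/eqP; have := v0 i; rewrite negbK.
rewrite /qf mul_mx_diag mxE (bigD1 i)//= ltr_pwDl//.
  by rewrite !mxE mulrAC -expr2 mulr_gt0// exprn_even_gt0.
by apply: sumr_ge0 => j _; rewrite !mxE mulrAC -expr2 mulr_ge0 ?sqr_ge0// ltW.
Qed.

Lemma spd_Sigma_y : spd (Sigma_y Phi g xi).
Proof. by apply: spdD_congr; [exact: spd_scalar|exact: spd_Upsilon]. Qed.

(* The precision matrix of x given y *)
Definition post_prec : 'M[R]_L :=
  invmx (Upsilon g) + Phi^T *m xi^-1%:M *m Phi.

Lemma spd_post_prec : spd post_prec.
Proof.
rewrite /post_prec -{2}[Phi]trmxK; apply: spdD_congr.
  exact/spd_inv/spd_Upsilon.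
by rewrite -invmx_scalar; exact/spd_inv/spd_scalar.
Qed.

Local Notation S := (Sigma_y Phi g xi).
Local Notation U := (Upsilon g).
Local Notation P := post_prec.

Lemma post_precE : P = invmx U + xi^-1 *: (Phi^T *m Phi).
Proof. by rewrite /post_prec mul_mx_scalar -scalemxAl. Qed.

(** The Woodbury identity. Since [S *m Phi = xi *: (Phi *m U *m P)], multiplying the right-hand side
    by S cancels P and leaves [xi^-1 *: (S - Phi *m U *m Phi^T)], the identity matrix. *)
Lemma invmx_Sigma_y :
  invmx S = xi^-1%:M - (xi^-1 ^+ 2) *: (Phi *m invmx P *m Phi^T).
Proof.
have xn0 : xi != 0 by rewrite gt_eqF.
have Uu := spd_unitmx spd_Upsilon.
have SPhi : S *m Phi = xi *: (Phi *m U *m P).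
  rewrite post_precE /Sigma_y mulmxDl mul_scalar_mx mulmxDr scalerDr mulmxK//.
  by rewrite -scalemxAr scalerA divff// scale1r !mulmxA.
apply: (can_inj (mulKmx (spd_unitmx spd_Sigma_y))).
rewrite mulmxV ?spd_unitmx//; last exact: spd_Sigma_y.
rewrite mulmxBr -scalemxAr !mulmxA SPhi -!scalemxAl mulmxK; last first.
  exact/spd_unitmx/spd_post_prec.
rewrite mul_mx_scalar /Sigma_y scalerDr scalerA expr2 -mulrA mulVf// mulr1.
by rewrite addrK scale_scalar_mx mulVf.
Qed.

Lemma det_Sigma_y : \det S = \det (xi%:M : 'M[R]_N) * \det U * \det P.
Proof.
have xn0 : xi != 0 by rewrite gt_eqF.
have Uu := spd_unitmx spd_Upsilon.
(* Both sides are Schur complement formulas for det M. *)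
pose M := block_mx xi%:M (- Phi) Phi^T (invmx U).
have e1 : \det M = \det (xi%:M : 'M[R]_N) * \det P.
  have : M *m block_mx 1%:M (xi^-1 *: Phi) 0 1%:M = block_mx xi%:M 0 Phi^T P.
    rewrite /M mulmx_block !mulmx1 !mulmx0 !addr0 mul_scalar_mx scalerA divff//.
    by rewrite scale1r subrr post_precE addrC -scalemxAr.
  move=> /(congr1 determinant); rewrite det_mulmx det_ublock !det1 mulr1 mulr1.
  by rewrite det_lblock.
have e2 : \det M = \det S * (\det U)^-1.
  have : M *m block_mx 1%:M 0 (- (U *m Phi^T)) 1%:M = block_mx S (- Phi) 0 (invmx U).
    rewrite /M mulmx_block !mulmx1 !mulmx0 !add0r mulNmx mulmxN opprK mulmxN.
    by rewrite mulKmx// subrr mulmxA.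
  move=> /(congr1 determinant); rewrite det_mulmx det_lblock !det1 mulr1 mulr1.
  by rewrite det_ublock det_inv.
have U0 : \det U != 0 by rewrite gt_eqF// spd_det_gt0//; exact: spd_Upsilon.
by rewrite mulrAC -e1 e2 divfK.
Qed.

End Marginal.

(** * Gaussian integrals and the marginal density *)

Section GaussianIntegral.
Context {R : realType}.

Lemma measurable_qf d (T : measurableType d) n (A : 'M[R]_n) (F : T -> n.-tuple R) :
  measurable_fun setT F -> measurable_fun setT (fun z => qf A (colv (F z))).
Proof.
move=> mF; under eq_fun do rewrite qfE.
apply: measurable_sum => i; apply: measurable_sum => j.
by apply: measurable_funM => //; apply: measurable_funM; exact: measurable_colv.
Qed.

Lemma integral_lebesgue_tupleS n (f : n.+1.-tuple R -> \bar R) :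
  measurable_fun setT f -> (forall t, 0 <= f t)%E ->
  (\int[lebesgue_tuple n.+1]_t f t =
   \int[lebesgue_tuple n]_z \int[lebesgue_measure]_x f (cons_pair (x, z)))%E.
Proof.
move=> mf f0.
transitivity (\int[lebesgue_measure \x lebesgue_tuple n]_w f (cons_pair w))%E.
  by rewrite ge0_integral_pushforward//; exact: measurable_cons_pair.
rewrite fubini_tonelli2//.
by apply: measurableT_comp => //; exact: measurable_cons_pair.
Qed.

(** Up to its normalising factor the integrand is the normal density of mean -m and variance 1/p. *)
Lemma integral_expR_sqr (p m : R) : 0 < p ->
  (\int[lebesgue_measure]_x (expR (- (p * (x + m) ^+ 2 / 2)))%:E =
   (Num.sqrt (2 * pi / p))%:E)%E.
Proof.
move=> p0; pose s := Num.sqrt p^-1.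
have s0 : s != 0 by rewrite gt_eqF// sqrtr_gt0 invr_gt0.
have s2 : s ^+ 2 = p^-1 by rewrite sqr_sqrtr// invr_ge0 ltW.
have -> : (fun x => (expR (- (p * (x + m) ^+ 2 / 2)))%:E) =
    (fun x => (Num.sqrt (2 * pi / p))%:E * (normal_pdf (- m) s x)%:E)%E.
  apply/funext => x; rewrite -EFinM normal_pdfE//= [in RHS]mulrA /normal_peak s2.
  rewrite (_ : p^-1 * pi *+ 2 = 2 * pi / p); last by rewrite -mulr_natl; ring.
  rewrite divff ?mul1r; last first.
    by rewrite gt_eqF// sqrtr_gt0 divr_gt0// mulr_gt0// pi_gt0.
  rewrite /normal_fun opprK s2; congr (expR _)%:E.
  by field; rewrite gt_eqF.
rewrite ge0_integralZl//.
- by rewrite integral_normal_pdf mule1.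
- by apply/measurable_EFinP; exact: measurable_normal_pdf.
- by move=> x _; rewrite lee_fin normal_pdf_ge0.
Qed.

Lemma measurable_expR_qf n (A : 'M[R]_n) :
  measurable_fun setT (fun t : n.-tuple R => (expR (- (qf A (colv t) / 2)))%:E).
Proof.
apply/measurable_EFinP; apply: measurableT_comp => //; apply: measurable_funN.
by apply: measurable_funM => //; exact: measurable_qf.
Qed.

(** Induction on the dimension: by [qf_schur] the first coordinate integrates to
    [Num.sqrt (2 * pi / p)] whatever the others are, leaving the form of the Schur complement, whose
    determinant is [\det P / p]. *)
Lemma integral_expR_qf n (P : 'M[R]_n) : spd P ->
  (\int[lebesgue_tuple n]_t (expR (- (qf P (colv t) / 2)))%:E =
   (Num.sqrt ((2 * pi) ^+ n / \det P))%:E)%E.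
Proof.
elim: n P => [|n IH] P spdP.
  rewrite integral_dirac//; last exact: measurable_expR_qf.
  rewrite diracE in_setT mul1e qfE big_ord0 mul0r oppr0 expR0 det_mx00.
  by rewrite expr0 divr1 sqrtr1.
pose p := schur_pivot P; have p0 : 0 < p := schur_pivot_gt0 spdP.
rewrite integral_lebesgue_tupleS; last 2 first.
- exact: measurable_expR_qf.
- by move=> t; rewrite lee_fin expR_ge0.
transitivity (\int[lebesgue_tuple n]_z ((Num.sqrt (2 * pi / p))%:E *
    (expR (- (qf (schur_compl P) (colv z) / 2)))%:E))%E.
  apply: eq_integral => z _.
  pose m := p^-1 * ((dlsubmx (P : 'M[R]_(1 + n)))^T *m colv z) 0 0.
  transitivity (\int[lebesgue_measure]_x
     ((expR (- (qf (schur_compl P) (colv z) / 2)))%:E *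
      (expR (- (p * (x + m) ^+ 2 / 2)))%:E))%E.
    apply: eq_integral => x _.
    rewrite -EFinM -expRD (_ : colv _ = col_mx x%:M (colv z)); last first.
      apply/matrixP => i j; rewrite ord1 !mxE.
      case: splitP => k ik; rewrite !mxE.
        by rewrite ord1 in ik *; rewrite (_ : i = ord0) ?eqxx//; exact: val_inj.
      rewrite (_ : i = lift ord0 k); last exact: val_inj.
      by rewrite tnthS /=; congr (tnth _ _); exact: val_inj.
    rewrite (qf_schur spdP); congr (expR _)%:E.
    by rewrite -/p -/m mulrDl opprD addrC.
  rewrite ge0_integralZl//.
  - by rewrite integral_expR_sqr// muleC.
  - apply/measurable_EFinP; apply: measurableT_comp => //; apply: measurable_funN.
    apply: measurable_funM => //; apply: measurable_funM => //.
    by apply: measurable_funX; exact: measurable_funD.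
rewrite ge0_integralZl//.
- rewrite IH; last exact: spd_schur.
  rewrite -EFinM -sqrtrM ?divr_ge0 ?(ltW p0)// ?mulr_ge0 ?pi_ge0//.
  rewrite (det_schur spdP) exprS; congr (Num.sqrt _)%:E; rewrite -/p.
  by rewrite invfM; ring.
- exact: measurable_expR_qf.
Qed.

Lemma gaussian_pdf0E n (S : 'M[R]_n) t : gaussian_pdf 0 S t =
  (Num.sqrt ((2 * pi) ^+ n * \det S))^-1 * expR (- (qf (invmx S) (colv t) / 2)).
Proof. by rewrite /gaussian_pdf subr0. Qed.

Lemma gaussian_peak_gt0 n (S : 'M[R]_n) : 0 < \det S ->
  0 < Num.sqrt ((2 * pi) ^+ n * \det S).
Proof.
by move=> S0; rewrite sqrtr_gt0 mulr_gt0// exprn_gt0// mulr_gt0// pi_gt0.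
Qed.

Lemma integral_gaussian_pdf n (S : 'M[R]_n) : spd S ->
  (\int[lebesgue_tuple n]_t (gaussian_pdf 0 S t)%:E = 1)%E.
Proof.
move=> spdS; under eq_integral do rewrite gaussian_pdf0E EFinM.
have S0 := gaussian_peak_gt0 (spd_det_gt0 spdS).
rewrite ge0_integralZl//.
- rewrite integral_expR_qf; last exact: spd_inv.
  by rewrite -EFinM det_inv invrK mulVf// gt_eqF.
- exact: measurable_expR_qf.
Qed.

Lemma measurable_gaussian_pdf0 n (S : 'M[R]_n) :
  measurable_fun setT (gaussian_pdf 0 S).
Proof. exact: measurable_gaussian_pdf. Qed.

Lemma integrable_gaussian_pdf n (S : 'M[R]_n) : spd S ->
  (lebesgue_tuple n).-integrable setT (EFin \o gaussian_pdf 0 S).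
Proof.
move=> spdS; apply/integrableP; split.
  by apply/measurable_EFinP; exact: measurable_gaussian_pdf0.
under eq_integral do rewrite /= ger0_norm ?gaussian_pdf_ge0//.
by rewrite integral_gaussian_pdf// ltry.
Qed.

End GaussianIntegral.

(** * Integrating out x *)

Section MarginalDensity.
Context {R : realType} {N L : nat}.
Variables (Phi : 'M[R]_(N, L)) (g : 'cV[R]_L) (xi : R).
Hypotheses (g0 : forall i, 0 < g i 0) (xi0 : 0 < xi).

Local Notation S := (Sigma_y Phi g xi).
Local Notation U := (Upsilon g).
Local Notation P := (post_prec Phi g xi).

(** The conditional mean of x given y = u. *)
Let post_mean (u : 'cV[R]_N) : 'cV[R]_L := xi^-1 *: (invmx P *m (Phi^T *m u)).

(** The exponent form of p(y | x) p(x) = p(x | y) p(y). On the right x occurs only through a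
    translated square; the terms in u alone match by the Woodbury identity. *)
Lemma qf_joint (u : 'cV[R]_N) (x : 'cV[R]_L) :
  qf (xi^-1%:M) (u - Phi *m x) + qf (invmx U) x =
  qf P (x - post_mean u) + qf (invmx S) u.
Proof.
have spdP : spd P := spd_post_prec Phi g0 xi0.
have mxZ a (A : 'M[R]_1) : (a *: A) 0 0 = a * A 0 0 by rewrite mxE.
have qfNv n (A : 'M[R]_n) v : qf A (- v) = qf A v.
  by rewrite -scaleN1r qfZ_vec sqrrN expr1n mul1r.
rewrite !qfD_vec ?tr_scalar_mx//; last exact: spdP.1.
rewrite !qfNv !mulmxN /post_mean -scalemxAr qfZ_vec.
rewrite -(mulmxA _ P) mulKVmx ?spd_unitmx//.
have -> : qf P (invmx P *m (Phi^T *m u)) = qf (Phi *m invmx P *m Phi^T) u.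
  by rewrite qf_congr qf_invmx ?spd_unitmx ?spdP.1.
rewrite (invmx_Sigma_y Phi g0 xi0) [qf (_ - _) u]qfD qfN qfZ post_precE qfD qfZ.
rewrite -[xi^-1%:M]scalemx1 !qfZ -scalemxAr mulmx1 -scalemxAl.
have mxN (A : 'M[R]_1) : (- A) 0 0 = - A 0 0 by rewrite mxE.
rewrite !mxN !mxZ.
have -> : qf 1%:M (Phi *m x) = qf (Phi^T *m Phi) x.
  by rewrite /qf mulmx1 trmx_mul !mulmxA.
have -> : (x^T *m (Phi^T *m u)) 0 0 = (u^T *m (Phi *m x)) 0 0.
  by rewrite -[LHS]trace_mx11 -mxtrace_tr trace_mx11 !trmx_mul !trmxK !mulmxA.
by ring.
Qed.

Lemma marginal_pdfE y : marginal_pdf Phi g xi y = gaussian_pdf 0 S y.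
Proof.
have spdP : spd P := spd_post_prec Phi g0 xi0.
have spdS : spd S := spd_Sigma_y Phi g0 xi0.
have detX : 0 < \det (xi%:M : 'M[R]_N) by apply: spd_det_gt0; exact: spd_scalar.
have detU : 0 < \det U by apply: spd_det_gt0; exact: spd_Upsilon.
have detP := spd_det_gt0 spdP.
(* Translation by minus the conditional mean; invariance of Lebesgue measure then removes it from
   the integral. *)
pose a : L.-tuple R := [tuple - post_mean (colv y) i 0 | i < L].
pose c := (Num.sqrt ((2 * pi) ^+ N * \det (xi%:M : 'M[R]_N)))^-1 *
  (Num.sqrt ((2 * pi) ^+ L * \det U))^-1.
pose f (x : L.-tuple R) := (expR (- (qf P (colv x) / 2)))%:E.
have integrandE x : gaussian_pdf (Phi *m colv x) xi%:M y * gaussian_pdf 0 U x =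
    c * expR (- (qf (invmx S) (colv y) / 2)) * expR (- (qf P (colv (shift_tuple a x)) / 2)).
  rewrite gaussian_pdf0E /gaussian_pdf -/(qf _ _) invmx_scalar mulrACA -/c.
  rewrite -mulrA -!expRD; congr (_ * expR _).
  have -> : colv (shift_tuple a x) = colv x - post_mean (colv y).
    by apply/matrixP => i j; rewrite ord1 [LHS]mxE [RHS]mxE [X in _ = X + _]mxE [X in _ = _ + X]mxE !tnth_mktuple.
  by rewrite -!opprD -!mulrDl qf_joint addrC.
rewrite /marginal_pdf (eq_Rintegral _ (g := fun x => _) (fun x _ => integrandE x)).
rewrite /Rintegral; under eq_integral do rewrite EFinM.
have c0 : 0 <= c by rewrite mulr_ge0 ?invr_ge0 ?sqrtr_ge0.
rewrite ge0_integralZl//; last 2 first.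
- exact: measurableT_comp (measurable_expR_qf P) (measurable_shift_tuple a).
- by rewrite lee_fin mulr_ge0 ?expR_ge0.
rewrite (@integral_lebesgue_tuple_shift _ _ a f); last 2 first.
- exact: measurable_expR_qf.
- by move=> x; rewrite lee_fin expR_ge0.
rewrite integral_expR_qf// -EFinM /= gaussian_pdf0E mulrAC; congr (_ * _).
have pi2 n : 0 < (2 * pi : R) ^+ n by rewrite exprn_gt0// mulr_gt0// pi_gt0.
rewrite (det_Sigma_y Phi g0 xi0) /c -!sqrtrV ?mulr_ge0 ?ltW ?mulr_gt0//.
rewrite -!sqrtrM ?invr_ge0 ?mulr_ge0 ?invr_ge0 ?mulr_ge0 ?ltW//.
congr Num.sqrt; field.
by rewrite !gt_eqF.
Qed.

End MarginalDensity.

(** * Derivatives of determinants, inverses and Gaussian densities *)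

Section Differentiation.
Context {R : realType} {V : normedModType R}.

(** The difference [g - f] vanishes near x, so its differential there is 0. This carries
    differentiability over from closed forms that are valid only locally. *)
Lemma near_eq_differentiable {W : normedModType R} (f g : V -> W) (x : V) :
  (\near x, f x = g x) -> differentiable f x -> differentiable g x.
Proof.
move=> fg df.
have k0 : \near x, (g - f) x = 0.
  by near=> z; apply/eqP; rewrite subr_eq0; apply/eqP/esym; near: z.
have -> : g = f + (g - f) by rewrite addrC subrK.
apply: differentiableD => //.
have ko : (g - f) \o shift x = cst ((g - f) x) + (\0 : V -> W) +o_ 0 id.
  apply/eqaddoE/eqaddoP => _/posnumP[e].
  rewrite [X in cst X](nbhs_singleton k0).
  near=> h; rewrite !fctE /=.
  suff -> : g (h + x) - f (h + x) = 0 by rewrite !addr0 subrr normr0 mulr_ge0.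
  by near: h; move: k0; rewrite (near_shift 0)/= subr0.
apply/diff_locallyP; have c0 : continuous (\0 : V -> W) by move=> z; exact: cvg_cst.
by rewrite (diff_unique (df := \0) c0 ko).
Unshelve. all: by end_near. Qed.

Lemma differentiable_bigsum I (r : seq I) (P : pred I) (h : I -> V -> R) x :
  (forall i, differentiable (h i) x) ->
  differentiable (fun t => \sum_(i <- r | P i) h i t) x.
Proof.
move=> dh; elim: r => [|i r IH].
  by under eq_fun do rewrite big_nil; exact: differentiable_cst.
under eq_fun do rewrite big_cons; by case: (P i) => //; exact: differentiableD.
Qed.

Lemma differentiable_bigprod I (r : seq I) (P : pred I) (h : I -> V -> R) x :
  (forall i, differentiable (h i) x) ->
  differentiable (fun t => \prod_(i <- r | P i) h i t) x.
Proof.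
move=> dh; elim: r => [|i r IH].
  by under eq_fun do rewrite big_nil; exact: differentiable_cst.
under eq_fun do rewrite big_cons; by case: (P i) => //; exact: differentiableM.
Qed.

Lemma differentiable_mulf (f g : V -> R) x :
  differentiable f x -> differentiable g x -> differentiable (fun t => f t * g t) x.
Proof. exact: differentiableM. Qed.

Lemma differentiable_col n (h : 'I_n -> V -> R) x :
  (forall i, differentiable (h i) x) ->
  differentiable (fun t => \col_i h i t : 'cV[R]_n) x.
Proof.
move=> dh; pose k i t : 'cV[R]_n := h i t *: delta_mx i 0.
rewrite (_ : (fun _ => _) = \sum_i k i); last first.
  apply/funext => t; rewrite fct_sumE; apply/matrixP => i j.
  rewrite ord1 summxE mxE (bigD1 i)//= big1 ?addr0 => [|l li]; last first.
    by rewrite !mxE eq_sym (negbTE li) mulr0.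
  by rewrite !mxE !eqxx mulr1.
by apply: differentiable_sum => i; exact: differentiableZl.
Qed.

Lemma is_derive_bigsum I (r : seq I) (P : pred I) (h : I -> V -> R) dh x v :
  (forall i, is_derive x v (h i) (dh i)) ->
  is_derive x v (fun t => \sum_(i <- r | P i) h i t) (\sum_(i <- r | P i) dh i).
Proof.
move=> dhi; elim: r => [|i r IH].
  by under eq_fun do rewrite big_nil; rewrite big_nil; exact: is_derive_cst.
by under eq_fun do rewrite big_cons; rewrite big_cons; case: (P i) => //; exact: is_deriveD.
Qed.

Lemma is_derive_mulf (f g : V -> R) x v df dg :
  is_derive x v f df -> is_derive x v g dg ->
  is_derive x v (fun t => f t * g t) (f x * dg + g x * df).
Proof. exact: is_deriveM. Qed.

(** The product rule with one factor replaced rather than removed: in the Leibniz expansion this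
    becomes a determinant with one row replaced. *)
Lemma is_derive_bigprod (I : eqType) (r : seq I) (h : I -> V -> R) dh x v :
  uniq r -> (forall i, is_derive x v (h i) (dh i)) ->
  is_derive x v (fun t => \prod_(i <- r) h i t)
    (\sum_(i <- r) \prod_(j <- r) (if j == i then dh j else h j x)).
Proof.
move=> + dhi; elim: r => [_|i r IH /= /andP[ir ur]].
  by under eq_fun do rewrite big_nil; rewrite big_nil; exact: is_derive_cst.
under eq_fun do rewrite big_cons; rewrite big_cons big_cons eqxx.
apply: is_derive_eq; first exact: (is_derive_mulf (dhi i) (IH ur)).
rewrite addrC mulrC mulr_sumr; congr (_ * _ + _).
  apply: eq_big_seq => j jr; case: eqP => // ji; by rewrite -ji jr in ir.
apply: eq_big_seq => j jr; rewrite big_cons; case: eqP => // ij.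
by rewrite ij jr in ir.
Qed.

(** Both sides have the same difference quotient; one-variable rules, the chain rule above all,
    thereby apply to directional derivatives. *)
Lemma is_derive_line (f : V -> R) x v df :
  is_derive x v f df <-> is_derive (0 : R) 1 (fun h => f (h *: v + x)) df.
Proof.
have E : (fun h : R => h^-1 *: (f (h *: v + x) - f x)) =
    (fun h => h^-1 *: (f ((h *: 1 + 0 : R) *: v + x) - f ((0 : R) *: v + x))).
  by apply/funext => h; rewrite addr0 scale0r add0r [_%:A]mulr1.
by split=> -[df1 df2]; apply: DeriveDef; move: df1 df2; rewrite /derivable /derive /= E.
Qed.

Lemma is_derive_scalar_comp (g : R -> R) (f : V -> R) x v df dg :
  is_derive x v f df -> is_derive (f x) 1 g dg ->
  is_derive x v (g \o f) (dg * df).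
Proof.
move=> /is_derive_line df1 dg1; apply/is_derive_line.
apply: (@is_derive1_comp _ g (fun h : R => f (h *: v + x)) 0) => //.
by rewrite scale0r add0r.
Qed.

Section MatrixCurve.
Variables (n : nat) (f : V -> 'M[R]_n) (x : V).
Hypothesis df : forall i j, differentiable (fun t => f t i j) x.

Lemma differentiable_det_fun : differentiable (fun t => \det (f t)) x.
Proof.
apply: differentiable_bigsum => s; apply: differentiable_mulf => //.
exact: differentiable_bigprod.
Qed.

End MatrixCurve.

Section InverseCurve.
Variables (n : nat) (f : V -> 'M[R]_n) (x : V).
Hypothesis df : forall i j, differentiable (fun t => f t i j) x.
Hypothesis fx : f x \in unitmx.

Lemma differentiable_adj i j : differentiable (fun t => (\adj (f t)) i j) x.
Proof.
under eq_fun do rewrite mxE; apply: differentiable_mulf => //.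
by apply: differentiable_det_fun => k l; under eq_fun do rewrite !mxE.
Qed.

Lemma near_unitmx : \near x, f x \in unitmx.
Proof.
have /differentiable_continuous := differentiable_det_fun df.
move: fx; rewrite unitmxE unitfE => /[swap] cf fx0.
near=> t; rewrite unitmxE unitfE; near: t.
exact: (cvgr_neq0 _ cf fx0).
Unshelve. all: by end_near. Qed.

Lemma differentiable_invmx i j : differentiable (fun t => invmx (f t) i j) x.
Proof.
(* [invmx] returns its argument on singular matrices, so the adjugate formula is used only near
   x. *)
apply: (near_eq_differentiable (f := fun t => (\det (f t))^-1 * (\adj (f t)) i j)).
  near=> t; rewrite /invmx ifT; first by rewrite [RHS]mxE.
  by near: t; exact: near_unitmx.
apply: differentiable_mulf; last exact: differentiable_adj.
apply: differentiableV; first exact: differentiable_det_fun.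
by move: fx; rewrite unitmxE unitfE.
Unshelve. all: by end_near. Qed.

Variables (v : V) (A : 'M[R]_n).
Hypothesis dfA : forall i j, is_derive x v (fun t => f t i j) (A i j).

(** Differentiability being known, the value is forced by differentiating
    [f t *m invmx (f t) = 1%:M], which holds near x. *)
Lemma is_derive_invmx i j :
  is_derive x v (fun t => invmx (f t) i j) (- (invmx (f x) *m A *m invmx (f x)) i j).
Proof.
pose D := \matrix_(i, j) 'D_v (fun t => invmx (f t) i j) x.
have dW k l : is_derive x v (fun t => invmx (f t) k l) (D k l).
  rewrite mxE; apply: derivableP; apply: diff_derivable.
  exact: differentiable_invmx.
suff E : D = - (invmx (f x) *m A *m invmx (f x)) by have := dW i j; rewrite E mxE.
have : f x *m D + A *m invmx (f x) = 0.
  apply/matrixP => k l; rewrite !mxE -big_split /=.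
  have d1 : is_derive x v (fun t => \sum_m f t k m * invmx (f t) m l)
      (\sum_m (f x k m * D m l + invmx (f x) m l * A k m)).
    by apply: is_derive_bigsum => m; exact: is_derive_mulf.
  have d0 : is_derive x v (fun t => \sum_m f t k m * invmx (f t) m l) 0.
    apply: (near_eq_is_derive (f := cst ((1%:M : 'M[R]_n) k l))).
      near=> t; rewrite -(@mulmxV _ _ (f t)) ?mxE//.
      by near: t; exact: near_unitmx.
  rewrite -[RHS](derive_val (is_derive := d0)) (derive_val (is_derive := d1)).
  by apply: eq_bigr => m _; rewrite [A k m * _]mulrC.
move=> /(congr1 (mulmx (invmx (f x)))); rewrite mulmx0 mulmxDr mulKmx// mulmxA.
by move/eqP; rewrite addr_eq0 => /eqP.
Unshelve. all: by end_near. Qed.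

(** Jacobi's formula. The product rule in the Leibniz expansion yields, for each i, the determinant
    with row i taken from A; expanding it along that row gives the trace of the adjugate times A. *)
Lemma is_derive_det :
  is_derive x v (fun t => \det (f t)) (\det (f x) * \tr (invmx (f x) *m A)).
Proof.
have d : is_derive x v (fun t => \det (f t)) (\sum_(s : {perm 'I_n}) (-1) ^+ s *
    \sum_(i < n) \prod_(j < n) (if j == i then A j (s j) else f x j (s j))).
  rewrite /determinant; apply: is_derive_bigsum => s.
  apply: is_derive_eq.
    apply: (is_derive_mulf (f := cst ((-1) ^+ s)) (df := 0)).
    by apply: is_derive_bigprod => //; exact: index_enum_uniq.
  by rewrite mulr0 addr0.
apply: (is_derive_eq d).
under eq_bigr do rewrite mulr_sumr.
rewrite exchange_big /= (eq_bigr (fun i => \sum_j A i j * cofactor (f x) i j)).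
  have -> : \det (f x) * \tr (invmx (f x) *m A) = \tr (\adj (f x) *m A).
    rewrite /invmx fx -scalemxAl mxtraceZ mulrA divff ?mul1r//.
    by move: fx; rewrite unitmxE unitfE.
  rewrite mxtrace_mulC /mxtrace; apply: eq_bigr => i _; rewrite mxE.
  by apply: eq_bigr => j _; rewrite [(\adj _) _ _]mxE.
move=> i _.
pose B := \matrix_(k, j) if k == i then A k j else f x k j.
transitivity (\det B).
  apply: eq_bigr => s _; congr (_ * _); apply: eq_bigr => j _.
  by rewrite mxE.
rewrite (expand_det_row _ i); apply: eq_bigr => j _.
rewrite mxE eqxx; congr (_ * _); rewrite /cofactor; congr (_ * \det _).
apply/matrixP => k l; rewrite !mxE.
by rewrite eq_sym (negbTE (neq_lift _ _)).
Qed.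

End InverseCurve.

End Differentiation.

(** * The Gaussian log density and its score *)

Section LogDensity.
Context {R : realType}.

(** The derivative of the log density at covariance S in the direction A, as [is_derive_loggauss]
    shows. *)
Definition score n (S A : 'M[R]_n) (y : 'cV[R]_n) : R :=
  2^-1 * (qf (invmx S *m A *m invmx S) y - \tr (invmx S *m A)).

Definition loggauss n (S : 'M[R]_n) (y : 'cV[R]_n) : R :=
  - 2^-1 * (ln ((2 * pi) ^+ n * \det S) + qf (invmx S) y).

Lemma gaussian_pdf_loggauss n (S : 'M[R]_n) t : 0 < \det S ->
  gaussian_pdf 0 S t = expR (loggauss S (colv t)).
Proof.
move=> S0; have c0 : 0 < (2 * pi : R) ^+ n * \det S.
  by rewrite mulr_gt0// exprn_gt0// mulr_gt0// pi_gt0.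
rewrite gaussian_pdf0E -powR12_sqrt ?ltW// /powR gt_eqF// -expRN -expRD.
by congr expR; rewrite /loggauss; field.
Qed.

Context {V : normedModType R}.

Section qf_curve.
Variables (n : nat) (G : V -> 'M[R]_n) (x v : V) (D : 'M[R]_n).

Lemma differentiable_qf y : (forall i j, differentiable (fun t => G t i j) x) ->
  differentiable (fun t => qf (G t) y) x.
Proof.
move=> dG; under eq_fun do rewrite qfE.
apply: differentiable_bigsum => i; apply: differentiable_bigsum => j.
exact: differentiable_mulf.
Qed.

Lemma is_derive_qf y : (forall i j, is_derive x v (fun t => G t i j) (D i j)) ->
  is_derive x v (fun t => qf (G t) y) (qf D y).
Proof.
move=> dG; under eq_fun do rewrite qfE; rewrite qfE.
apply: is_derive_bigsum => i; apply: is_derive_bigsum => j.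
by apply: is_derive_eq; rewrite scaler0 add0r; exact: mulrC.
Qed.

Lemma is_derive_trace : (forall i j, is_derive x v (fun t => G t i j) (D i j)) ->
  is_derive x v (fun t => \tr (G t)) (\tr D).
Proof. by move=> dG; apply: is_derive_bigsum. Qed.

End qf_curve.

Section mulmx_curve.
Variables (n : nat) (F G : V -> 'M[R]_n) (x v : V) (A B : 'M[R]_n).

Lemma differentiable_mulmx_entry i j :
  (forall i j, differentiable (fun t => F t i j) x) ->
  (forall i j, differentiable (fun t => G t i j) x) ->
  differentiable (fun t => (F t *m G t) i j) x.
Proof.
move=> dF dG; under eq_fun do rewrite mxE.
by apply: differentiable_bigsum => k; exact: differentiable_mulf.
Qed.

Lemma is_derive_mulmx_entry i j :
  (forall i j, is_derive x v (fun t => F t i j) (A i j)) ->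
  (forall i j, is_derive x v (fun t => G t i j) (B i j)) ->
  is_derive x v (fun t => (F t *m G t) i j) ((A *m G x + F x *m B) i j).
Proof.
move=> dF dG; under eq_fun do rewrite mxE; rewrite !mxE -big_split/=.
apply: is_derive_bigsum => k; apply: is_derive_eq.
by rewrite addrC; congr (_ + _); exact: mulrC.
Qed.

End mulmx_curve.

Section LogDensityCurve.
Variables (n : nat) (f : V -> 'M[R]_n) (x : V).
Hypothesis df : forall i j, differentiable (fun t => f t i j) x.
Hypothesis fx : 0 < \det (f x).

Let fu : f x \in unitmx. Proof. by rewrite unitmxE unitfE gt_eqF. Qed.

Let c0 : 0 < (2 * pi : R) ^+ n * \det (f x).
Proof. by rewrite mulr_gt0// exprn_gt0// mulr_gt0// pi_gt0. Qed.

Lemma differentiable_loggauss y : differentiable (fun t => loggauss (f t) y) x.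
Proof.
apply: differentiable_mulf => //; apply: differentiableD; last first.
  by apply: differentiable_qf => i j; exact: differentiable_invmx.
have dln : differentiable (@ln R) ((2 * pi) ^+ n * \det (f x)).
  by apply/derivable1_diffP; have [] := is_derive1_ln c0.
apply: (@differentiable_comp _ _ _ _ (fun t => (2 * pi) ^+ n * \det (f t)) _ _ _ dln).
by apply: differentiable_mulf => //; exact: differentiable_det_fun.
Qed.

Lemma differentiable_invmx_sandwich A i j :
  differentiable (fun t => (invmx (f t) *m A *m invmx (f t)) i j) x.
Proof.
apply: differentiable_mulmx_entry => k l; last exact: differentiable_invmx.
by apply: differentiable_mulmx_entry => k' l' //; exact: differentiable_invmx.
Qed.

Lemma differentiable_score A y : differentiable (fun t => score (f t) A y) x.
Proof.
apply: differentiable_mulf => //; apply: differentiableB.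
  by apply: differentiable_qf => i j; exact: differentiable_invmx_sandwich.
apply: differentiable_bigsum => i.
by apply: differentiable_mulmx_entry => k l //; exact: differentiable_invmx.
Qed.

Variables (v : V) (A : 'M[R]_n).
Hypothesis dfA : forall i j, is_derive x v (fun t => f t i j) (A i j).
Local Notation Si := (invmx (f x)).

Let dinv i j : is_derive x v (fun t => invmx (f t) i j) ((- (Si *m A *m Si)) i j).
Proof. by rewrite mxE; exact: is_derive_invmx. Qed.

Lemma is_derive_loggauss y :
  is_derive x v (fun t => loggauss (f t) y) (score (f x) A y).
Proof.
have d1 : is_derive x v (fun t => (2 * pi) ^+ n * \det (f t))
    ((2 * pi) ^+ n * (\det (f x) * \tr (Si *m A))).
  have d0 := is_derive_mulf (is_derive_cst ((2 * pi : R) ^+ n) x v)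
    (is_derive_det fu dfA).
  apply: (is_derive_eq d0).
  by rewrite mulr0 addr0.
have d2 := is_derive_scalar_comp d1 (is_derive1_ln c0).
have d3 := is_deriveD d2 (is_derive_qf y dinv).
apply: (is_derive_eq (is_derive_mulf (is_derive_cst (- 2^-1 : R) x v) d3)).
rewrite mulr0 addr0 /score qfN [_ ^+ n * (_ * _)]mulrA mulKf ?gt_eqF// /cst.
by ring.
Qed.

(** B is held constant: for a covariance linear in the parameter, its directional derivatives do not
    depend on the point, so this is the full second derivative of the log density. *)
Lemma is_derive_score B y : is_derive x v (fun t => score (f t) B y)
  (2^-1 * (\tr (Si *m A *m Si *m B) -
    qf (Si *m A *m Si *m B *m Si + Si *m B *m Si *m A *m Si) y)).
Proof.
have dB i j : is_derive x v (fun t => (cst B t) i j) ((0 : 'M[R]_n) i j).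
  by rewrite mxE; exact: is_derive_cst.
have d1 i j := is_derive_mulmx_entry i j dinv dB.
have d2 i j := is_derive_mulmx_entry i j d1 dinv.
have d3 := is_deriveB (is_derive_qf y d2) (is_derive_trace d1).
apply: (is_derive_eq (is_derive_mulf (is_derive_cst (2^-1 : R) x v) d3)).
rewrite mulr0 addr0 /cst mulmx0 addr0 !mulNmx mulmxN -opprD qfN !mulmxA.
by rewrite linearN opprK addrC.
Qed.

Lemma near_det_gt0 : \near x, 0 < \det (f x).
Proof.
have /differentiable_continuous cf := differentiable_det_fun df.
exact: (cvgr_gt _ cf _ fx).
Qed.

Lemma is_derive_gaussian_pdf y :
  is_derive x v (fun t => gaussian_pdf 0 (f t) y)
    (score (f x) A (colv y) * gaussian_pdf 0 (f x) y).
Proof.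
apply: (near_eq_is_derive (f := fun t => expR (loggauss (f t) (colv y)))).
  near=> t; rewrite gaussian_pdf_loggauss//.
  by near: t; exact: near_det_gt0.
rewrite mulrC gaussian_pdf_loggauss//.
apply: (is_derive_scalar_comp (is_derive_loggauss (colv y))).
Unshelve. all: by end_near. Qed.

End LogDensityCurve.

End LogDensity.

(** * Differentiation under the integral sign *)

Section Domination.
Context {R : realType} {n : nat}.
Variables (S A : 'M[R]_n).
Hypothesis spdS : spd S.

Definition pencil (h : R) : 'M[R]_n := S + h *: A.
Local Notation f := pencil.

Lemma differentiable_pencil (h : R) i j : differentiable (fun h => f h i j) h.
Proof.
under eq_fun do rewrite /pencil mxE [X in _ + X]mxE.
by apply: differentiableD => //; apply: differentiable_mulf.
Qed.

Lemma is_derive_pencil (h : R) i j : is_derive h 1 (fun h => f h i j) (A i j).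
Proof.
under eq_fun do rewrite /pencil mxE [X in _ + X]mxE.
have d := is_deriveD (is_derive_cst (S i j : R) h 1)
  (is_derive_mulf (is_derive_id (h : R) 1) (is_derive_cst (A i j : R) h 1)).
by apply: (is_derive_eq d); rewrite mulr0 !add0r mulr1.
Qed.

Let f0 : f 0 = S. Proof. by rewrite /pencil scale0r addr0. Qed.

Let det_f0 : 0 < \det (f 0). Proof. by rewrite f0 spd_det_gt0. Qed.

Let f0u : f 0 \in unitmx. Proof. by rewrite f0 spd_unitmx. Qed.

Let near_sum_norm_lt (M : R -> 'M[R]_n) b :
  (forall i j, differentiable (fun h => M h i j) 0) ->
  \sum_i \sum_j `|M 0 i j| < b ->
  \forall h \near 0, \sum_i \sum_j `|M h i j| < b.
Proof.
move=> dM Mb.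
have cM : (fun h => \sum_i \sum_j `|M h i j|) @ 0 --> \sum_i \sum_j `|M 0 i j|.
  apply: cvg_big => [|i _]; first exact: add_continuous.
  apply: cvg_big => [|j _]; first exact: add_continuous.
  apply: cvg_norm.
  exact: differentiable_continuous (dM i j).
exact: (cvgr_lt _ cM _ Mb).
Qed.

(* Near h = 0 the exponent for S + h A is at most that for 2 S minus a multiple
   of |y|^2, which absorbs the quadratic growth of the score. *)
Lemma gaussian_pdf_dominated : exists C, \forall h \near 0, forall y,
  gaussian_pdf 0 (f h) y <= C * gaussian_pdf 0 (2 *: S) y /\
  `|score (f h) A (colv y) * gaussian_pdf 0 (f h) y| <=
    C * gaussian_pdf 0 (2 *: S) y.
Proof.
have [c c0 coerc] := spd_coercive (spd_inv spdS).
have Su := spd_unitmx spdS.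
pose B h := invmx (f h) *m A *m invmx (f h).
pose b := 1 + \sum_i \sum_j `|B 0 i j|.
pose t := 1 + `|\tr (invmx (f 0) *m A)|.
pose k h := (Num.sqrt ((2 * pi) ^+ n * \det (f h)))^-1.
pose K := (Num.sqrt ((2 * pi) ^+ n * \det (2 *: S)))^-1.
have K0 : 0 < K.
  by rewrite invr_gt0 gaussian_peak_gt0// spd_det_gt0//; exact: spdZ.
have b0 : 0 < b by rewrite ltr_pwDl// sumr_ge0// => i _; rewrite sumr_ge0.
have t0 : 0 < t by rewrite ltr_pwDl.
have k0 : 0 <= k 0 by rewrite invr_ge0 sqrtr_ge0.
(* [k 0 + 1] bounds the normalising factor near 0, [K] is the one for 2 S, and the last factor
   bounds both 1 and the score multiplied by the spare decay [e]. *)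
exists ((k 0 + 1) / K * (1 + 2^-1 * (8 * b / c + t))).
have ct : {for 0, continuous (fun h => \tr (invmx (f h) *m A))}.
  apply: differentiable_continuous; apply: differentiable_bigsum => i.
  apply: differentiable_mulmx_entry => // k' l.
  by apply: differentiable_invmx => // i' j'; exact: differentiable_pencil.
have ck : k h @[h --> 0] --> k 0.
  apply: cvgV; first by rewrite gt_eqF// gaussian_peak_gt0.
  apply: continuous_cvg; first exact: sqrt_continuous.
  have d : differentiable (fun h => (2 * pi) ^+ n * \det (f h)) 0.
    apply: differentiable_mulf => //; apply: differentiable_det_fun => i j.
    exact: differentiable_pencil.
  exact: (differentiable_continuous d).
near=> h => y.
have dh : 0 < \det (f h).
  near: h; apply: (near_det_gt0 (f := f)) => // i j; exact: differentiable_pencil.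
have Bh : \sum_i \sum_j `|B h i j| < b.
  near: h; apply: near_sum_norm_lt; last by rewrite ltrDr.
  move=> i j; apply: differentiable_invmx_sandwich => // k' l.
  exact: differentiable_pencil.
have th : `|\tr (invmx (f h) *m A)| < t.
  by near: h; apply: (cvgr_norm_lt _ ct); rewrite /t ltrDr.
have kh : k h < k 0 + 1.
  by near: h; apply: (cvgr_lt _ ck); rewrite ltrDl.
(* With [c * s <= q], the tolerance c / 4 keeps the form of [invmx (f h)] above q / 2 + c s / 4: the
   first term is the form for 2 S, the second becomes [e]. *)
have qh : \sum_i \sum_j `|(invmx (f h) - invmx S) i j| < c / 4.
  near: h; apply: near_sum_norm_lt => [i j|].
    under eq_fun do rewrite mxE [X in _ + X]mxE.
    apply: differentiableB => //.
    by apply: differentiable_invmx => // i' j'; exact: differentiable_pencil.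
  rewrite f0 subrr big1 ?divr_gt0// => i _; rewrite big1// => j _.
  by rewrite mxE normr0.
set s := qf 1%:M (colv y); have s0 : 0 <= s := qf1_ge0 _.
set q := qf (invmx S) (colv y).
have qs : c * s <= q by exact: coerc.
have qhs : q - c / 4 * s <= qf (invmx (f h)) (colv y).
  rewrite lerBlDr -lerBlDl -qfN -qfD -opprB qfN.
  rewrite (le_trans (ler_norm _))// normrN (le_trans (qf_le _ _))//.
  by rewrite ler_wpM2r// ltW.
pose e := expR (- (c * s / 8)).
have e0 : 0 < e by exact: expR_gt0.
have e1 : e <= 1.
  by rewrite -expR0 ler_expR oppr_le0 divr_ge0// mulr_ge0// ltW.
have G2 : gaussian_pdf 0 (2 *: S) y = K * expR (- (q / 4)).
  have S2u : 2 *: S \in unitmx by apply: spd_unitmx; exact: spdZ.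
  rewrite gaussian_pdf0E -/K (invmxZ S2u) qfZ -/q; congr (_ * expR _); by field.
have Gh : gaussian_pdf 0 (f h) y <= (k 0 + 1) * expR (- (q / 4)) * e.
  rewrite gaussian_pdf0E -/(k h) -mulrA -expRD.
  apply: ler_pM; rewrite ?expR_ge0 ?invr_ge0 ?sqrtr_ge0 ?(ltW kh)// ler_expR.
  move: qs qhs; set Q := qf _ _; lra.
have E0 : 0 < (k 0 + 1) * expR (- (q / 4)) by rewrite mulr_gt0 ?expR_gt0// ltr_wpDl.
have se : 2^-1 * (b * s + t) * e <= 2^-1 * (8 * b / c + t).
  rewrite -mulrA ler_pM2l// mulrDl lerD//; last first.
    by rewrite ler_piMr// ltW.
  (* From [x <= expR x] at x = c s / 8; scaled by 8 b / c it bounds the quadratic part of the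
     score. *)
  have : c * s / 8 * e <= 1.
    rewrite /e expRN -ler_pdivlMr ?invr_gt0 ?expR_gt0// invrK mul1r.
    by rewrite (le_trans _ (expR_ge1Dx _))// lerDr.
  have bc : 0 <= 8 * b / c by rewrite divr_ge0 ?mulr_ge0// ltW.
  move=> /(ler_wpM2l bc); rewrite mulr1; apply: le_trans; rewrite le_eqVlt.
  by apply/orP; left; apply/eqP; field; rewrite gt_eqF.
have sc : `|score (f h) A (colv y)| <= 2^-1 * (b * s + t).
  rewrite /score normrM ger0_norm// ler_pM2l//.
  apply: (le_trans (ler_normB _ _)); apply: lerD; last exact: ltW.
  by apply: (le_trans (qf_le _ _)); rewrite ler_wpM2r// ltW.
have -> : (k 0 + 1) / K * (1 + 2^-1 * (8 * b / c + t)) * gaussian_pdf 0 (2 *: S) y =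
    (k 0 + 1) * expR (- (q / 4)) * (1 + 2^-1 * (8 * b / c + t)).
  by rewrite G2; field; rewrite !gt_eqF.
have r0 : 0 <= 2^-1 * (8 * b / c + t).
  by rewrite mulr_ge0// addr_ge0 ?ltW// divr_gt0// mulr_gt0.
split.
  rewrite (le_trans Gh)// ler_pM2l// (le_trans e1)// lerDl//.
rewrite normrM [X in _ * X]ger0_norm ?gaussian_pdf_ge0//.
apply: (@le_trans _ _ (2^-1 * (b * s + t) * ((k 0 + 1) * expR (- (q / 4)) * e))).
  by apply: ler_pM => //; exact: gaussian_pdf_ge0.
rewrite mulrCA ler_pM2l// (le_trans se)// lerDr//.
Unshelve. all: by end_near. Qed.

End Domination.

Section DifferentiationUnderGaussian.
Context {R : realType} {n : nat}.
Variables (S A : 'M[R]_n).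
Hypothesis spdS : spd S.
Variable F : n.-tuple R -> R.
Hypothesis mF : measurable_fun setT F.
Local Notation mu := (lebesgue_tuple n).
Hypothesis intF : mu.-integrable setT
  (fun y => (F y * gaussian_pdf 0 (2 *: S) y)%:E).

Lemma measurable_score (T B : 'M[R]_n) :
  measurable_fun setT (fun y : n.-tuple R => score T B (colv y)).
Proof.
apply: measurable_funM => //; apply: measurable_funB => //.
exact: measurable_qf.
Qed.

Let G2 (C : R) (y : n.-tuple R) := `|C * (F y * gaussian_pdf 0 (2 *: S) y)|.

Let intG2 C : mu.-integrable setT (EFin \o G2 C).
Proof.
apply: (@integrable_norm _ _ _ _ _ (fun y => C * (F y * gaussian_pdf 0 (2 *: S) y))) => //.
exact: (integrableZl measurableT C intF).
Qed.

Let int_dom C (g : n.-tuple R -> R) : measurable_fun setT g ->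
  (forall y, `|g y| <= C * gaussian_pdf 0 (2 *: S) y) ->
  mu.-integrable setT (fun y => (F y * g y)%:E) /\
  (forall y, `|F y * g y| <= G2 C y).
Proof.
move=> mg gC; have le y : `|F y * g y| <= G2 C y.
  rewrite /G2 mulrCA normrM [leRHS]normrM ler_wpM2l// (le_trans (gC y))//.
  exact: ler_norm.
split=> //; apply: le_integrable (intG2 C) => //.
  by apply/measurable_EFinP; exact: measurable_funM.
by move=> y _; rewrite !abse_EFin lee_fin normr_id.
Qed.

Lemma integrable_score_gaussian : mu.-integrable setT
  (fun y => (F y * (score S A (colv y) * gaussian_pdf 0 S y))%:E).
Proof.
have [C /nbhs_singleton dom] := gaussian_pdf_dominated A spdS.
have mg : measurable_fun setT (fun y => score S A (colv y) * gaussian_pdf 0 S y).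
  by apply: measurable_funM; [exact: measurable_score|exact: measurable_gaussian_pdf0].
have le y : `|score S A (colv y) * gaussian_pdf 0 S y| <= C * gaussian_pdf 0 (2 *: S) y.
  by have [_] := dom y; rewrite /pencil scale0r addr0.
exact: (int_dom mg le).1.
Qed.

Lemma is_derive_integral_gaussian : is_derive (0 : R) 1
  (fun h => \int[mu]_y (F y * gaussian_pdf 0 (S + h *: A) y))
  (\int[mu]_y (F y * (score S A (colv y) * gaussian_pdf 0 S y))).
Proof.
have [C dom] := gaussian_pdf_dominated A spdS.
have ddet : \forall h \near 0, 0 < \det (pencil S A h).
  apply: (near_det_gt0 (f := pencil S A)).
    by move=> i j; exact: differentiable_pencil.
  by rewrite /pencil scale0r addr0 spd_det_gt0.
(* Differentiation under the integral is applied on an open interval with one majorant for all its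
   points. *)
have [e /= e0 He] : exists2 e : R, 0 < e & forall h, h \in `]-e, e[ ->
    0 < \det (pencil S A h) /\ forall y,
    gaussian_pdf 0 (pencil S A h) y <= C * gaussian_pdf 0 (2 *: S) y /\
    `|score (pencil S A h) A (colv y) * gaussian_pdf 0 (pencil S A h) y| <=
      C * gaussian_pdf 0 (2 *: S) y.
  have [e /= e0 He] := (nbhs_normP (0 : R) _).1 (filterI ddet dom).
  exists e => // h; rewrite in_itv/= => he; apply: He.
  by rewrite /= sub0r normrN ltr_norml.
pose f h y := F y * gaussian_pdf 0 (pencil S A h) y.
have df h y : h \in `]-e, e[ -> is_derive h 1 (f ^~ y)
    (F y * (score (pencil S A h) A (colv y) * gaussian_pdf 0 (pencil S A h) y)).
  move=> /He[dh _].
  have d := is_derive_gaussian_pdf (f := pencil S A)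
    (fun i j => differentiable_pencil S A h i j) dh
    (fun i j => is_derive_pencil S A h i j) y.
  apply: (is_derive_eq (is_derive_mulf (is_derive_cst (F y : R) h 1) d)).
  by rewrite mulr0 addr0.
have I0 : `]-e, e[%classic (0 : R) by rewrite /= in_itv/= oppr_lt0 e0.
have d1E h y : h \in `]-e, e[ -> partial1of2 f h y =
    F y * (score (pencil S A h) A (colv y) * gaussian_pdf 0 (pencil S A h) y).
  by move=> /(df _ y) d; rewrite partial1of2E derive_val.
have intf h : `]-e, e[%classic h -> mu.-integrable setT (EFin \o f h).
  move=> /= /He[_ dh].
  have le y : `|gaussian_pdf 0 (pencil S A h) y| <= C * gaussian_pdf 0 (2 *: S) y.
    by rewrite ger0_norm ?gaussian_pdf_ge0//; have [] := dh y.
  exact: (int_dom (measurable_gaussian_pdf0 (pencil S A h)) le).1.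
have derf h y : `]-e, e[%classic h -> setT y -> derivable (f ^~ y) h 1.
  by move=> /= /(df _ y)[].
have ubf h y : `]-e, e[%classic h -> setT y -> `|partial1of2 f h y| <= G2 C y.
  move=> /= hI _; rewrite d1E// /G2 [in leRHS]mulrCA normrM [leRHS]normrM ler_wpM2l//.
  have [_ /(_ y)[_ /le_trans]] := He _ hI; apply.
  exact: ler_norm.
have G20 y : 0 <= G2 C y by exact: normr_ge0.
have E := differentiation_under_integral measurableT I0 intf derf G20 (intG2 C) ubf.
have D := derivable_under_integral measurableT I0 intf derf G20 (intG2 C) ubf.
apply: DeriveDef => //.
rewrite -derive1E E; apply: eq_Rintegral => y _.
by rewrite d1E// /pencil scale0r addr0.
Qed.

End DifferentiationUnderGaussian.

(** * Gaussian moments *)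

Section GaussianMoments.
Context {R : realType} {n : nat}.
Local Notation mu := (@lebesgue_tuple R n).

(** Coercivity of S absorbs the form of [h *: A] for small h. Closed forms of Gaussian moments thus
    remain available around h = 0 and can be differentiated there. *)
Lemma near_spd_pencil (S A : 'M[R]_n) : spd S -> A^T = A ->
  \forall h \near 0, spd (S + h *: A).
Proof.
move=> spdS sA; have [c c0 coerc] := spd_coercive spdS.
pose a := 1 + \sum_i \sum_j `|A i j|.
have a0 : 0 < a by rewrite ltr_pwDl// sumr_ge0// => i _; rewrite sumr_ge0.
near=> h; split=> [|v v0]; first by rewrite linearD linearZ /= sA spdS.1.
have ha : `|h| * a < c.
  rewrite -ltr_pdivlMr//; near: h; apply: (cvgr_norm_lt (0 : R)).
    exact: cvg_id.
  by rewrite normr0 divr_gt0.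
have v1 : 0 < qf 1%:M v.
  have spd1 : spd (1%:M : 'M[R]_n) by apply: spd_scalar.
  exact: spd1.2.
have hA : `|qf (h *: A) v| < c * qf 1%:M v.
  rewrite qfZ normrM; apply: le_lt_trans (_ : `|h| * a * qf 1%:M v < _).
    rewrite -mulrA ler_wpM2l// (le_trans (qf_le _ _))// ler_wpM2r ?qf1_ge0//.
    by rewrite lerDr.
  by rewrite ltr_pM2r.
rewrite qfD; move: hA; rewrite ltr_norml => /andP[hA _].
by have := coerc v; lra.
Unshelve. all: by end_near. Qed.

(** The device behind every moment identity below that comes from a derivative: one function of h is
    differentiated under the integral and again from its closed form near 0. *)
Lemma is_derive_unique_near (f g : R -> R) (x : R) a b :
  is_derive x 1 f a -> is_derive x 1 g b -> (\near x, f x = g x) -> a = b.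
Proof.
move=> fa gb fg; have fb := near_eq_is_derive fg fa.
by rewrite -(derive_val (is_derive := fb)) (derive_val (is_derive := gb)).
Qed.

Lemma Rintegral_gaussian_pdf (S : 'M[R]_n) : spd S ->
  \int[mu]_y gaussian_pdf 0 S y = 1.
Proof. by move=> spdS; rewrite /Rintegral integral_gaussian_pdf. Qed.

Lemma integrable_gaussian_score (S A : 'M[R]_n) : spd S ->
  mu.-integrable setT (fun y => (score S A (colv y) * gaussian_pdf 0 S y)%:E).
Proof.
move=> spdS; rewrite (_ : (fun y => _) =
  fun y => (cst 1 y * (score S A (colv y) * gaussian_pdf 0 S y))%:E); last first.
  by apply/funext => y; rewrite mul1r.
apply: integrable_score_gaussian => //.
by under eq_fun do rewrite mul1r; apply: integrable_gaussian_pdf; exact: spdZ.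
Qed.

Lemma Rintegral_gaussian_score (S A : 'M[R]_n) : spd S -> A^T = A ->
  \int[mu]_y (score S A (colv y) * gaussian_pdf 0 S y) = 0.
Proof.
move=> spdS sA.
have i2 : mu.-integrable setT (fun y => (cst 1 y * gaussian_pdf 0 (2 *: S) y)%:E).
  by under eq_fun do rewrite mul1r; apply: integrable_gaussian_pdf; exact: spdZ.
have := is_derive_integral_gaussian A spdS (measurable_cst (1 : R)) i2.
have -> : \int[mu]_y (cst 1 y * (score S A (colv y) * gaussian_pdf 0 S y)) =
    \int[mu]_y (score S A (colv y) * gaussian_pdf 0 S y).
  by apply: eq_Rintegral => y _; rewrite mul1r.
move=> di; apply: (is_derive_unique_near di (is_derive_cst (1 : R) (0 : R) 1)).
near=> h; rewrite /cst -[RHS](@Rintegral_gaussian_pdf (S + h *: A)).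
  by apply: eq_Rintegral => y _; rewrite mul1r.
by near: h; exact: near_spd_pencil.
Unshelve. all: by end_near. Qed.

Section second_moment.
Variables (S B : 'M[R]_n).
Hypotheses (spdS : spd S) (sB : B^T = B).

Let Su := spd_unitmx spdS.

(** In the direction S B S the inverses cancel, so every centered quadratic form is, up to a factor
    2, a score; its moment follows from the vanishing mean of scores. *)
Let scoreE y : score S (S *m B *m S) y = 2^-1 * (qf B y - \tr (B *m S)).
Proof. by rewrite /score !mulmxA mulVmx// mul1mx mulmxK. Qed.

Let qfE_score y : qf B (colv y) * gaussian_pdf 0 S y =
  2 * (score S (S *m B *m S) (colv y) * gaussian_pdf 0 S y) +
  \tr (B *m S) * gaussian_pdf 0 S y.
Proof. by rewrite scoreE; field. Qed.

Let i1 := integrable_gaussian_score (S *m B *m S) spdS.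
Let i2 := integrable_gaussian_pdf spdS.

Lemma integrable_qf_gaussian : mu.-integrable setT
  (fun y => (qf B (colv y) * gaussian_pdf 0 S y)%:E).
Proof.
under eq_fun do rewrite qfE_score EFinD.
apply: integrableD => //.
  exact: (integrableZl measurableT 2 i1).
exact: (integrableZl measurableT (\tr (B *m S)) i2).
Qed.

Lemma Rintegral_qf_gaussian :
  \int[mu]_y (qf B (colv y) * gaussian_pdf 0 S y) = \tr (B *m S).
Proof.
under eq_Rintegral do rewrite qfE_score.
rewrite RintegralD//; last 2 first.
- exact: (integrableZl measurableT 2 i1).
- exact: (integrableZl measurableT (\tr (B *m S)) i2).
rewrite RintegralZl// RintegralZl// Rintegral_gaussian_pdf// Rintegral_gaussian_score//.
  by rewrite mulr0 mulr1 add0r.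
by rewrite !trmx_mul sB spdS.1 mulmxA.
Qed.

End second_moment.

(** The second moment tr (B (S + h A)) is affine in h, and the integral is its slope. Fourth moments
    of y are never expanded. *)
Lemma Rintegral_qf_score (S A B : 'M[R]_n) : spd S -> A^T = A -> B^T = B ->
  \int[mu]_y (qf B (colv y) * (score S A (colv y) * gaussian_pdf 0 S y)) =
  \tr (B *m A).
Proof.
move=> spdS sA sB.
have mB : measurable_fun setT (fun y : n.-tuple R => qf B (colv y)).
  exact: measurable_qf.
have i2 := integrable_qf_gaussian B (spdZ (ltr0n R 2) spdS).
have := is_derive_integral_gaussian A spdS mB i2.
have d : is_derive (0 : R) 1 (fun h => \tr (B *m S) + h * \tr (B *m A)) (\tr (B *m A)).
  have := is_deriveD (is_derive_cst (\tr (B *m S) : R) (0 : R) 1)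
    (is_derive_mulf (is_derive_id (0 : R) 1) (is_derive_cst (\tr (B *m A) : R) (0 : R) 1)).
  by move=> /is_derive_eq; apply; rewrite mulr0 !add0r mulr1.
move=> di; apply: (is_derive_unique_near di d).
near=> h; rewrite Rintegral_qf_gaussian//.
  by rewrite mulmxDr -scalemxAr mxtraceD mxtraceZ.
by near: h; exact: near_spd_pencil.
Unshelve. all: by end_near. Qed.

Section score_score.
Variables (S A B : 'M[R]_n).
Hypotheses (spdS : spd S) (sA : A^T = A) (sB : B^T = B).

Let C := invmx S *m B *m invmx S.

Let sC : C^T = C.
Proof. by rewrite /C !trmx_mul !trmx_inv spdS.1 sB mulmxA. Qed.

Let scoreBE y : score S B y = 2^-1 * (qf C y - \tr (invmx S *m B)).
Proof. by []. Qed.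

Lemma integrable_score_score : mu.-integrable setT (fun y =>
  (score S B (colv y) * (score S A (colv y) * gaussian_pdf 0 S y))%:E).
Proof.
apply: integrable_score_gaussian => //; first exact: measurable_score.
have spd2 : spd (2 *: S) by exact: spdZ.
rewrite (_ : (fun y => _) = fun y : n.-tuple R =>
  ((2^-1)%:E * (qf C (colv y) * gaussian_pdf 0 (2 *: S) y)%:E +
   (- (2^-1 * \tr (invmx S *m B)))%:E * (gaussian_pdf 0 (2 *: S) y)%:E)%E); last first.
  by apply/funext => y; rewrite -!EFinM -EFinD scoreBE; congr EFin; ring.
apply: integrableD => //; apply: integrableZl => //.
  exact: integrable_qf_gaussian.
exact: integrable_gaussian_pdf.
Qed.

(** The constant part of one score integrates to 0 against the other, which leaves a quadratic form
    against a score. *)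
Lemma Rintegral_score_score :
  \int[mu]_y (score S B (colv y) * (score S A (colv y) * gaussian_pdf 0 S y)) =
  2^-1 * \tr (invmx S *m B *m invmx S *m A).
Proof.
have iq : mu.-integrable setT (fun y =>
    (qf C (colv y) * (score S A (colv y) * gaussian_pdf 0 S y))%:E).
  apply: integrable_score_gaussian => //; first exact: measurable_qf.
  by apply: integrable_qf_gaussian => //; exact: spdZ.
have isc := integrable_gaussian_score A spdS.
rewrite (eq_Rintegral _ (g := fun y : n.-tuple R =>
   2^-1 * (qf C (colv y) * (score S A (colv y) * gaussian_pdf 0 S y)) -
   2^-1 * \tr (invmx S *m B) * (score S A (colv y) * gaussian_pdf 0 S y))); last first.
  by move=> y _; rewrite scoreBE; ring.
rewrite RintegralB//; last 2 first.
- exact: (integrableZl measurableT 2^-1 iq).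
- exact: (integrableZl measurableT (2^-1 * \tr (invmx S *m B)) isc).
rewrite RintegralZl// RintegralZl// Rintegral_gaussian_score// Rintegral_qf_score//.
by rewrite mulr0 subr0.
Qed.

End score_score.

End GaussianMoments.

Section LinearCombination.
Context d (T : measurableType d) (R : realType) (mu : {measure set T -> \bar R}).

Lemma integrable_lincomb (I : Type) (s : seq I) (c : I -> R) (f : I -> T -> R) :
  (forall i, mu.-integrable setT (EFin \o f i)) ->
  mu.-integrable setT (EFin \o (fun y => \sum_(i <- s) c i * f i y)).
Proof.
move=> intf; rewrite (_ : EFin \o _ = fun y => (\sum_(i <- s) (c i)%:E * (f i y)%:E)%E).
  by apply: integrable_sum => // i _; exact: (integrableZl measurableT (c i) (intf i)).
by apply/funext => y; rewrite /= -sumEFin; apply: eq_bigr => i _; rewrite EFinM.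
Qed.

Lemma Rintegral_lincomb (I : Type) (s : seq I) (c : I -> R) (f : I -> T -> R) :
  (forall i, mu.-integrable setT (EFin \o f i)) ->
  \int[mu]_y (\sum_(i <- s) c i * f i y) = \sum_(i <- s) c i * \int[mu]_y f i y.
Proof.
move=> intf; elim: s => [|i s IH].
  under eq_Rintegral do rewrite big_nil.
  by rewrite big_nil /Rintegral integral0.
under eq_Rintegral do rewrite big_cons.
rewrite big_cons RintegralD//; last 2 first.
- exact: (integrableZl measurableT (c i) (intf i)).
- exact: integrable_lincomb.
by rewrite RintegralZl// IH.
Qed.

End LinearCombination.

(** * The model *)

Section CovarianceMap.
Context {R : realType} {N L : nat}.
Variable Phi : 'M[R]_(N, L).

(* Defined for all t, although it is a covariance only for positive t, so as to
   be a linear map. *)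
Definition cov (t : 'cV[R]_(L + 1)) : 'M[R]_N :=
  Sigma_y Phi (usubmx t) (dsubmx t 0 0).

Lemma covE t i j : cov t i j = t (rshift L 0) 0 *+ (i == j) +
  \sum_k Phi i k * t (lshift 1 k) 0 * Phi j k.
Proof.
rewrite /cov /Sigma_y /Upsilon mul_mx_diag !mxE; congr (_ + _).
by apply: eq_bigr => k _; rewrite !mxE.
Qed.

Lemma cov_is_linear : linear cov.
Proof.
move=> a u v; apply/matrixP => i j; rewrite [RHS]mxE [in RHS]mxE !covE !mxE.
rewrite mulrDr mulr_sumr addrACA mulrnAr -mulrnDl; congr (_ + _).
by rewrite -big_split; apply: eq_bigr => k _; rewrite !mxE /=; ring.
Qed.

HB.instance Definition _ := GRing.isLinear.Build R _ _ _ cov cov_is_linear.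

Lemma cov_pencil v t h : cov (h *: v + t) = pencil (cov t) (cov v) h.
Proof. by rewrite linearP addrC. Qed.

Lemma tr_cov t : (cov t)^T = cov t.
Proof.
apply/matrixP => i j; rewrite mxE !covE eq_sym; congr (_ + _).
by apply: eq_bigr => k _; ring.
Qed.

Lemma cov_theta g xi : cov (theta g xi) = Sigma_y Phi g xi.
Proof. by rewrite /cov /theta col_mxKu col_mxKd mxE eqxx mulr1n. Qed.

(** The partial derivative of the covariance in coordinate k, the same at every t by linearity. *)
Definition cov_dir k : 'M[R]_N := cov (delta_mx k 0).

Lemma cov_dir_lshift i : cov_dir (lshift 1 i) = col i Phi *m (col i Phi)^T.
Proof.
apply/matrixP => a b; rewrite covE !mxE big_ord1 !mxE.
rewrite eq_rlshift /= mul0rn add0r (bigD1 i)//= big1 => [|k ki]; last first.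
  by rewrite mxE (inj_eq (@lshift_inj _ _)) (negbTE ki) mulr0 mul0r.
by rewrite !mxE !eqxx addr0 mulr1.
Qed.

Lemma cov_dir_rshift : cov_dir (rshift L 0) = 1%:M.
Proof.
apply/matrixP => a b; rewrite covE !mxE !eqxx big1 ?addr0// => k _.
by rewrite mxE eq_lrshift mulr0 mul0r.
Qed.

Lemma cov_sum v : cov v = \sum_k v k 0 *: cov_dir k.
Proof.
rewrite {1}[v]matrix_sum_delta linear_sum; apply: eq_bigr => k _.
by rewrite big_ord1 linearZ.
Qed.

Definition pos_col (t : 'cV[R]_(L + 1)) := forall k, 0 < t k 0.

Lemma pos_colP t : pos_col t ->
  (forall i, 0 < usubmx t i 0) /\ 0 < dsubmx t 0 0.
Proof. by move=> t0; split=> [i|]; rewrite mxE. Qed.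

Lemma theta_split (t : 'cV[R]_(L + 1)) : theta (usubmx t) (dsubmx t 0 0) = t.
Proof. by rewrite /theta -mx11_scalar vsubmxK. Qed.

Lemma pos_theta (g : 'cV[R]_L) xi : (forall i, 0 < g i 0) -> 0 < xi -> pos_col (theta g xi).
Proof.
move=> g0 xi0 k; rewrite /theta mxE; case: splitP => j _ //.
by rewrite ord1 mxE eqxx mulr1n.
Qed.

(** Openness of the parameter domain: it turns formulas proved for positive parameters into local
    equalities that can be differentiated. *)
Lemma near_pos_col t : pos_col t -> \forall s \near t, pos_col s.
Proof.
move=> t0; apply: (filter_forall (F := nbhs t)
  (f := fun k (s : 'cV[R]_(L + 1)) => 0 < s k 0)) => k.
have ck : {for t, continuous (fun s : 'cV[R]_(L + 1) => s k 0)}.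
  exact: coord_continuous.
exact: (cvgr_gt _ ck _ (t0 k)).
Qed.

Lemma spd_cov t : pos_col t -> spd (cov t).
Proof. by move=> /pos_colP[g0 xi0]; exact: spd_Sigma_y. Qed.

Lemma differentiable_cov t i j : differentiable (fun t => cov t i j) t.
Proof.
have dc k : differentiable (fun t : 'cV[R]_(L + 1) => t k 0 : R) t.
  exact: differentiable_coord.
under eq_fun do rewrite covE -mulr_natr.
apply: differentiableD; first exact: differentiable_mulf.
apply: differentiable_bigsum => k; apply: differentiable_mulf => //.
exact: differentiable_mulf.
Qed.

Lemma is_derive_cov t v i j : is_derive t v (fun t => cov t i j) (cov v i j).
Proof.
apply/is_derive_line; under eq_fun do rewrite cov_pencil.
exact: is_derive_pencil.
Qed.

Lemma marginal_pdf_cov t : pos_col t ->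
  marginal_pdf Phi (usubmx t) (dsubmx t 0 0) = gaussian_pdf 0 (cov t).
Proof. by move=> /pos_colP[g0 xi0]; apply/funext => y; rewrite marginal_pdfE. Qed.

Lemma loglik_cov y t : pos_col t -> loglik Phi y t = loggauss (cov t) (colv y).
Proof.
move=> t0; rewrite /loglik marginal_pdf_cov// gaussian_pdf_loggauss ?expRK//.
exact/spd_det_gt0/spd_cov.
Qed.

Lemma near_loglik_cov y t : pos_col t ->
  \forall s \near t, loggauss (cov s) (colv y) = loglik Phi y s.
Proof.
by move=> t0; near=> s; rewrite loglik_cov//; near: s; exact: near_pos_col.
Unshelve. all: by end_near. Qed.

Lemma differentiable_loglik y t : pos_col t -> differentiable (loglik Phi y) t.
Proof.
move=> t0; apply: near_eq_differentiable (near_loglik_cov y t0) _.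
apply: differentiable_loggauss; first by move=> i j; exact: differentiable_cov.
exact/spd_det_gt0/spd_cov.
Qed.

Lemma derive_loglik y t v : pos_col t ->
  'D_v (loglik Phi y) t = score (cov t) (cov v) (colv y).
Proof.
move=> t0; have d0 := spd_det_gt0 (spd_cov t0).
have d := is_derive_loggauss (differentiable_cov t) d0 (is_derive_cov t v) (colv y).
exact: (derive_val (is_derive := near_eq_is_derive (near_loglik_cov y t0) d)).
Qed.

Lemma grad_loglik y t : pos_col t ->
  grad (loglik Phi y) t = \col_k score (cov t) (cov_dir k) (colv y).
Proof. by move=> t0; apply/matrixP => i j; rewrite !mxE derive_loglik. Qed.

Lemma differentiable_grad_loglik y t : pos_col t ->
  differentiable (grad (loglik Phi y)) t.
Proof.
move=> t0; apply: (near_eq_differentiable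
    (f := fun t => \col_k score (cov t) (cov_dir k) (colv y))).
  by near=> s; rewrite grad_loglik//; near: s; exact: near_pos_col.
apply: differentiable_col => k; apply: differentiable_score.
  by move=> i j; exact: differentiable_cov.
exact/spd_det_gt0/spd_cov.
Unshelve. all: by end_near. Qed.

Lemma hessian_loglik y t i j : pos_col t ->
  let Si := invmx (cov t) in let A := cov_dir i in let B := cov_dir j in
  hessian (loglik Phi y) t i j = 2^-1 * (\tr (Si *m A *m Si *m B) -
    qf (Si *m A *m Si *m B *m Si + Si *m B *m Si *m A *m Si) (colv y)).
Proof.
move=> t0 Si A B; rewrite mxE.
have d0 := spd_det_gt0 (spd_cov t0).
have d := is_derive_score (differentiable_cov t) d0 (is_derive_cov t (delta_mx i 0))
  B (colv y).
rewrite -[RHS](derive_val (is_derive := d)); apply: near_eq_derive.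
by near=> s; rewrite derive_loglik//; near: s; exact: near_pos_col.
Unshelve. all: by end_near. Qed.

End CovarianceMap.

(** * Mean score and Fisher information *)

Section Fisher.
Context {R : realType} {N L : nat}.
Variables (Phi : 'M[R]_(N, L)) (g : 'cV[R]_L) (xi : R).
Hypotheses (g0 : forall i, 0 < g i 0) (xi0 : 0 < xi).
Local Notation t := (theta g xi).
Local Notation S := (cov Phi t).
Local Notation A := (cov_dir Phi).
Local Notation mu := (@lebesgue_tuple R N).

Let t0 : pos_col t := pos_theta g0 xi0.
Let spdS : spd S := spd_cov Phi t0.

Lemma marginal_pdf_theta : marginal_pdf Phi g xi = gaussian_pdf 0 S.
Proof. by apply/funext => y; rewrite cov_theta marginal_pdfE. Qed.

Lemma has_expectation_grad :
  has_expectation Phi g xi (fun y => grad (loglik Phi y) t).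
Proof.
move=> i j; rewrite marginal_pdf_theta.
under eq_fun do rewrite grad_loglik// mxE.
exact: integrable_gaussian_score.
Qed.

Lemma expectation_grad :
  expectation_y Phi g xi (fun y => grad (loglik Phi y) t) = 0.
Proof.
apply/matrixP => i j; rewrite mxE [RHS]mxE marginal_pdf_theta.
under eq_Rintegral do rewrite grad_loglik// mxE.
by rewrite Rintegral_gaussian_score// tr_cov.
Qed.

Section hessian_entry.
Variables i j : 'I_(L + 1).

Let Si := invmx S.
Let H := Si *m A i *m Si *m A j *m Si + Si *m A j *m Si *m A i *m Si.
Let c := 2^-1 * \tr (Si *m A i *m Si *m A j).

Let sH : H^T = H.
Proof.
rewrite /H linearD /= !trmx_mul !trmx_inv !tr_cov !mulmxA.
by rewrite addrC.
Qed.

Let trHS : \tr (H *m S) = 2 * \tr (Si *m A i *m Si *m A j).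
Proof.
rewrite /H mulmxDl !mulmxKV ?spd_unitmx// mxtraceD.
rewrite -[Si *m A j *m Si *m A i]mulmxA [\tr (Si *m A j *m _)]mxtrace_mulC.
by rewrite !mulmxA; ring.
Qed.

Let hessE y : hessian (loglik Phi y) t i j * gaussian_pdf 0 S y =
  c * gaussian_pdf 0 S y - 2^-1 * (qf H (colv y) * gaussian_pdf 0 S y).
Proof. by rewrite hessian_loglik//= /c /H; ring. Qed.

Let i1 := integrable_gaussian_pdf spdS.
Let i2 := integrable_qf_gaussian H spdS.

Lemma integrable_hessian : mu.-integrable setT
  (fun y => (hessian (loglik Phi y) t i j * gaussian_pdf 0 S y)%:E).
Proof.
under eq_fun do rewrite hessE EFinB.
apply: integrableB => //.
  exact: (integrableZl measurableT c i1).
exact: (integrableZl measurableT 2^-1 i2).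
Qed.

(** With T the trace on the right, the Hessian entry is half of T minus a quadratic form whose mean
    is 2 T, the two summands of [H] having equal traces by cyclicity. Its expectation is therefore
    -T / 2. *)
Lemma fisherE :
  fisher Phi g xi i j = 2^-1 * \tr (invmx S *m A i *m invmx S *m A j).
Proof.
rewrite mxE mxE marginal_pdf_theta; under eq_Rintegral do rewrite hessE.
rewrite RintegralB//; last 2 first.
- exact: (integrableZl measurableT c i1).
- exact: (integrableZl measurableT 2^-1 i2).
rewrite RintegralZl// [X in _ - X]RintegralZl// Rintegral_gaussian_pdf//.
by rewrite Rintegral_qf_gaussian// trHS /c; field.
Qed.

End hessian_entry.

Lemma tr_fisher : (fisher Phi g xi)^T = fisher Phi g xi.
Proof.
apply/matrixP => i j; rewrite mxE !fisherE; congr (_ * _).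
by rewrite -[_ *m A i]mulmxA mxtrace_mulC !mulmxA.
Qed.

(** The right-hand side is the value of [Rintegral_score_score] at [cov Phi u] taken twice: the
    Hessian form of the information equals the variance of the score along u. *)
Lemma qf_fisher u : qf (fisher Phi g xi) u =
  2^-1 * \tr (invmx S *m cov Phi u *m invmx S *m cov Phi u).
Proof.
have E : invmx S *m cov Phi u = \sum_k u k 0 *: (invmx S *m A k).
  by rewrite [cov Phi u]cov_sum mulmx_sumr; apply: eq_bigr => k _; rewrite -scalemxAr.
rewrite -mulmxA E mulmx_suml linear_sum mulr_sumr qfE; apply: eq_bigr => k _.
rewrite mulmx_sumr linear_sum mulr_sumr; apply: eq_bigr => l _.
by rewrite /= -scalemxAl -scalemxAr !mxtraceZ fisherE !mulmxA; ring.
Qed.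

Lemma fisher_block : let Si := invmx (Sigma_y Phi g xi) in
  fisher Phi g xi = block_mx
    (\matrix_(i < L, j < L)
       (2^-1 * (((col j Phi)^T *m Si *m col i Phi) 0 0) ^+ 2))
    (\col_(i < L) (2^-1 * ((col i Phi)^T *m (Si *m Si) *m col i Phi) 0 0))
    (\row_(i < L) (2^-1 * ((col i Phi)^T *m (Si *m Si) *m col i Phi) 0 0))
    (2^-1 * \tr (Si *m Si))%:M.
Proof.
move=> Si; have SiE : invmx S = Si by rewrite cov_theta.
have tr_outer (B : 'M[R]_N) u : \tr (B *m (u *m u^T)) = qf B u.
  by rewrite /qf mulmxA mxtrace_mulC trace_mx11 mulmxA.
have symSi : Si^T = Si by rewrite -SiE trmx_inv spdS.1.
apply/matrixP => i j; rewrite fisherE SiE.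
case: (split_ordP i) => k ->; case: (split_ordP j) => l ->.
- rewrite block_mxEul mxE !cov_dir_lshift tr_outer; congr (_ * _).
  (* The conjugated rank-one matrix is w w^T with w = Si Phi_k, so its form at Phi_l is the square
     of a scalar. *)
  have -> : Si *m (col k Phi *m (col k Phi)^T) *m Si =
      Si *m col k Phi *m 1%:M *m (Si *m col k Phi)^T.
    by rewrite mulmx1 trmx_mul symSi !mulmxA.
  rewrite qf_congr qf1E big_ord1 trmx_mul symSi; congr (_ ^+ 2).
  exact: bilin_sym.
- rewrite block_mxEur mxE cov_dir_lshift [l]ord1 cov_dir_rshift mulmx1.
  by rewrite mxtrace_mulC mulmxA tr_outer.
- by rewrite block_mxEdl mxE cov_dir_lshift [k]ord1 cov_dir_rshift mulmx1 tr_outer.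
- by rewrite block_mxEdr mxE [k]ord1 [l]ord1 cov_dir_rshift !mulmx1 eqxx mulr1n.
Qed.

End Fisher.

(** * The Cramer-Rao bound *)

Section CramerRao.
Context {R : realType} {N L : nat}.
Variables (Phi : 'M[R]_(N, L)) (est : N.-tuple R -> (L + 1).-tuple R).
Hypothesis adm : admissible Phi est.
Local Notation mu := (@lebesgue_tuple R N).

Definition est_along (v : 'cV[R]_(L + 1)) y : R := \sum_k v k 0 * colv (est y) k 0.

Lemma measurable_est_along v : measurable_fun setT (est_along v).
Proof.
apply: measurable_sum => k; apply: measurable_funM => //.
by apply: measurable_colv; exact: adm.1.
Qed.

Lemma admissible_cov s k : pos_col s ->
  mu.-integrable setT (EFin \o (fun y => colv (est y) k 0 * gaussian_pdf 0 (cov Phi s) y)) /\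
  \int[mu]_y (colv (est y) k 0 * gaussian_pdf 0 (cov Phi s) y) = s k 0.
Proof.
move=> s0; have [g0 xi0] := pos_colP s0.
have [_ int_est E] := adm.2 _ _ g0 xi0.
rewrite -marginal_pdf_cov//; split; first exact: int_est.
by have := congr1 (fun M : 'cV[R]_(L + 1) => M k 0) E; rewrite mxE theta_split.
Qed.

Let est_alongE v s y : est_along v y * gaussian_pdf 0 (cov Phi s) y =
  \sum_k v k 0 * (colv (est y) k 0 * gaussian_pdf 0 (cov Phi s) y).
Proof. by rewrite mulr_suml; apply: eq_bigr => k _; rewrite mulrA. Qed.

Lemma integrable_est_along v s : pos_col s -> mu.-integrable setT
  (fun y => (est_along v y * gaussian_pdf 0 (cov Phi s) y)%:E).
Proof.
move=> s0; under eq_fun do rewrite est_alongE.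
exact: (integrable_lincomb _ _ (fun k => (admissible_cov k s0).1)).
Qed.

Lemma Rintegral_est_along v s : pos_col s ->
  \int[mu]_y (est_along v y * gaussian_pdf 0 (cov Phi s) y) =
  \sum_k v k 0 * s k 0.
Proof.
move=> s0; under eq_Rintegral do rewrite est_alongE.
rewrite (Rintegral_lincomb _ _ (fun k => (admissible_cov k s0).1)).
by apply: eq_bigr => k _; rewrite (admissible_cov k s0).2.
Qed.

Variables (g : 'cV[R]_L) (xi : R).
Hypotheses (g0 : forall i, 0 < g i 0) (xi0 : 0 < xi).
Local Notation t := (theta g xi).
Local Notation S := (cov Phi t).

Let t0 : pos_col t := pos_theta g0 xi0.
Let spdS : spd S := spd_cov Phi t0.

Let int2 v : mu.-integrable setT
  (fun y => (est_along v y * gaussian_pdf 0 (2 *: S) y)%:E).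
Proof.
have -> : 2 *: S = cov Phi (2 *: t) by rewrite linearZ.
by apply: integrable_est_along => k; rewrite mxE mulr_gt0.
Qed.

Lemma integrable_est_score v u : mu.-integrable setT (fun y =>
  (est_along v y * (score S (cov Phi u) (colv y) * gaussian_pdf 0 S y))%:E).
Proof.
apply: integrable_score_gaussian => //; exact: measurable_est_along.
Qed.

(* Differentiate the unbiasedness identity [Rintegral_est_along] along [u]. *)
Lemma Rintegral_est_score v u :
  \int[mu]_y (est_along v y * (score S (cov Phi u) (colv y) * gaussian_pdf 0 S y)) =
  \sum_k v k 0 * u k 0.
Proof.
have di := is_derive_integral_gaussian (cov Phi u) spdS (measurable_est_along v) (int2 v).
have d : is_derive (0 : R) 1
    (fun h => \sum_k v k 0 * t k 0 + h * \sum_k v k 0 * u k 0) (\sum_k v k 0 * u k 0).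
  have := is_deriveD (is_derive_cst (\sum_k v k 0 * t k 0 : R) (0 : R) 1)
    (is_derive_mulf (is_derive_id (0 : R) 1)
       (is_derive_cst (\sum_k v k 0 * u k 0 : R) (0 : R) 1)).
  by move=> /is_derive_eq; apply; rewrite mulr0 !add0r mulr1.
apply: (is_derive_unique_near di d).
(* Unbiasedness is known at positive parameters only, and u is arbitrary, so h must be small. *)
have pos_h : \forall h \near (0 : R), pos_col (h *: u + t).
  apply: (filter_forall (F := nbhs (0 : R))
    (f := fun k (h : R) => 0 < (h *: u + t) k 0)) => k.
  have ch : {for (0 : R), continuous (fun h : R => h * u k 0 + t k 0)}.
    by apply: differentiable_continuous; apply: differentiableD.
  have h0 : 0 < 0 * u k 0 + t k 0 by rewrite mul0r add0r.
  by near=> h; rewrite 2!mxE; near: h; exact: (cvgr_gt _ ch _ h0).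
near=> h.
have <- : cov Phi (h *: u + t) = S + h *: cov Phi u by exact: cov_pencil.
rewrite Rintegral_est_along; last by near: h.
rewrite mulr_sumr -big_split; apply: eq_bigr => k _ /=.
by rewrite 2!mxE; ring.
Unshelve. all: by end_near. Qed.

Definition err_along (v : 'cV[R]_(L + 1)) y : R :=
  \sum_k v k 0 * t k 0 - est_along v y.

Lemma err_along_sqr v y : err_along v y ^+ 2 = qf (sqerr g xi est y) v.
Proof.
rewrite /sqerr; set D := (X in X *m _).
rewrite (_ : D *m _ = D *m 1%:M *m D^T); last by rewrite mulmx1.
rewrite qf_congr qf1E big_ord1; congr (_ ^+ 2).
rewrite /err_along /est_along mxE -sumrB; apply: eq_bigr => k _.
have mxB (a b : 'cV[R]_(L + 1)) : (a - b) k 0 = a k 0 - b k 0 by rewrite !mxE.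
by rewrite [D^T _ _]mxE mxB; ring.
Qed.

Let qf_pairE (M : 'M[R]_(L + 1)) v : qf M v =
  \sum_(p : 'I_(L + 1) * 'I_(L + 1)) (v p.1 0 * v p.2 0) * M p.1 p.2.
Proof.
rewrite qfE pair_bigA /=; apply: eq_bigr => p _; exact: mulrC.
Qed.

Let sqerr_gaussian (p : 'I_(L + 1) * 'I_(L + 1)) (y : N.-tuple R) :=
  sqerr g xi est y p.1 p.2 * gaussian_pdf 0 S y.

Let int_sqerr p : mu.-integrable setT (EFin \o sqerr_gaussian p).
Proof.
have [int_sq _ _] := adm.2 _ _ g0 xi0; have := int_sq p.1 p.2.
by rewrite (marginal_pdf_theta Phi g0 xi0).
Qed.

Let err_along_sqrE v y : err_along v y ^+ 2 * gaussian_pdf 0 S y =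
  \sum_p (v p.1 0 * v p.2 0) * sqerr_gaussian p y.
Proof.
by rewrite err_along_sqr qf_pairE mulr_suml; apply: eq_bigr => p _; rewrite -[LHS]mulrA.
Qed.

Lemma integrable_err_sqr v : mu.-integrable setT
  (fun y => (err_along v y ^+ 2 * gaussian_pdf 0 S y)%:E).
Proof.
under eq_fun do rewrite err_along_sqrE.
exact: (integrable_lincomb _ _ int_sqerr).
Qed.

Lemma Rintegral_err_sqr v :
  \int[mu]_y (err_along v y ^+ 2 * gaussian_pdf 0 S y) = qf (mse Phi g xi est) v.
Proof.
under eq_Rintegral do rewrite err_along_sqrE.
rewrite (Rintegral_lincomb _ _ int_sqerr) qf_pairE; apply: eq_bigr => p _.
by rewrite mxE (marginal_pdf_theta Phi g0 xi0).
Qed.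

Lemma cramer_rao_qf (v u : 'cV[R]_(L + 1)) :
  0 <= qf (mse Phi g xi est) v - 2 * (\sum_k v k 0 * u k 0) + qf (fisher Phi g xi) u.
Proof.
pose sc y := score S (cov Phi u) (colv y).
pose G y := gaussian_pdf 0 S y.
have i1 := integrable_err_sqr v.
have i2 := integrable_est_score v u.
have i3 := integrable_gaussian_score (cov Phi u) spdS.
have i4 := integrable_score_score (cov Phi u) (cov Phi u) spdS.
pose c := \sum_k v k 0 * t k 0.
have i5 : mu.-integrable setT (fun y => (2 * c * (sc y * G y))%:E).
  exact: (integrableZl measurableT (2 * c) i3).
have i6 : mu.-integrable setT (fun y => (2 * (est_along v y * (sc y * G y)))%:E).
  exact: (integrableZl measurableT 2 i2).
have i7 : mu.-integrable setT
    (fun y => (err_along v y ^+ 2 * G y + 2 * c * (sc y * G y))%:E).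
  exact: (integrableD measurableT i1 i5).
have i8 : mu.-integrable setT (fun y => (err_along v y ^+ 2 * G y +
    2 * c * (sc y * G y) - 2 * (est_along v y * (sc y * G y)))%:E).
  exact: (integrableB measurableT i7 i6).
have : 0 <= \int[mu]_y ((err_along v y + sc y) ^+ 2 * G y).
  by apply: Rintegral_ge0 => y _; rewrite mulr_ge0 ?sqr_ge0 ?gaussian_pdf_ge0.
(* The error is c minus the estimator along v: the constant c meets a score of mean 0, and the
   estimator contributes -2 v . u. *)
rewrite (eq_Rintegral _ (g := fun y => err_along v y ^+ 2 * G y +
    2 * c * (sc y * G y) - 2 * (est_along v y * (sc y * G y)) +
    sc y * (sc y * G y))); last by move=> y _; rewrite /err_along -/c; ring.
rewrite RintegralD// RintegralB// RintegralD//.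
rewrite RintegralZl// [X in _ - X]RintegralZl//.
rewrite Rintegral_err_sqr Rintegral_est_score Rintegral_score_score ?tr_cov//.
rewrite Rintegral_gaussian_score ?tr_cov// mulr0 addr0.
by rewrite (qf_fisher Phi g0 xi0).
Qed.

Lemma tr_mse : (mse Phi g xi est)^T = mse Phi g xi est.
Proof.
apply/matrixP => i j; rewrite !mxE; apply: eq_Rintegral => y _; congr (_ * _).
by rewrite !mxE !big_ord1 !mxE mulrC.
Qed.

Lemma cramer_rao : fisher Phi g xi \in unitmx ->
  loewner_ge (mse Phi g xi est) (invmx (fisher Phi g xi)).
Proof.
move=> Mu; have sM := tr_fisher Phi g0 xi0; split=> [|v].
  by rewrite linearB /= trmx_inv tr_mse sM.
(* With q the form of the inverse at v, the last two terms of [cramer_rao_qf] become -2 q and q,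
   which leaves the form of the mean squared error minus q. *)
pose u := invmx (fisher Phi g xi) *m v.
have vu : \sum_k v k 0 * u k 0 = qf (invmx (fisher Phi g xi)) v.
  by rewrite /qf -mulmxA [RHS]mxE; apply: eq_bigr => k _; rewrite [v^T _ _]mxE.
have := cramer_rao_qf v u; rewrite vu qf_invmx//.
rewrite -/(qf _ _) qfD qfN; lra.
Qed.

End CramerRao.

Theorem theorem4 (R : realType) (N L : nat) (N_gt0 : (0 < N)%N)
    (L_gt0 : (0 < L)%N) (Phi : 'M[R]_(N, L)) :
  (forall (gamma : 'cV[R]_L) (xi : R),
    (forall i, 0 < gamma i 0) -> 0 < xi ->
    [/\ forall y, differentiable (loglik Phi y) (theta gamma xi),
        has_expectation Phi gamma xi
          (fun y => grad (loglik Phi y) (theta gamma xi)) &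
        expectation_y Phi gamma xi
          (fun y => grad (loglik Phi y) (theta gamma xi)) = 0]) /\
  (forall (gamma : 'cV[R]_L) (xi : R),
    (forall i, 0 < gamma i 0) -> 0 < xi ->
    let Si := invmx (Sigma_y Phi gamma xi) in
    let M := fisher Phi gamma xi in
    [/\ forall y, differentiable (grad (loglik Phi y)) (theta gamma xi),
        has_expectation Phi gamma xi
          (fun y => hessian (loglik Phi y) (theta gamma xi)),
        M = block_mx
          (\matrix_(i < L, j < L)
             (2^-1 * (((col j Phi)^T *m Si *m col i Phi) 0 0) ^+ 2))
          (\col_(i < L)
             (2^-1 * ((col i Phi)^T *m (Si *m Si) *m col i Phi) 0 0))
          (\row_(i < L)
             (2^-1 * ((col i Phi)^T *m (Si *m Si) *m col i Phi) 0 0))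
          (2^-1 * \tr (Si *m Si))%:M &
        M \in unitmx ->
        forall est : N.-tuple R -> (L + 1).-tuple R,
          admissible Phi est ->
          loewner_ge (mse Phi gamma xi est) (invmx M)]).
Proof.
split=> g xi g0 xi0.
  split=> [y||].
  - exact/differentiable_loglik/pos_theta.
  - exact: has_expectation_grad.
  - exact: expectation_grad.
move=> Si M; split=> [y|i j||Mu est adm].
- exact/differentiable_grad_loglik/pos_theta.
- by rewrite marginal_pdf_theta//; exact: integrable_hessian.
- exact: fisher_block.
- exact: cramer_rao.
Qed.
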